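(* For every integer $m\ge2$, $$\dim_{\mathbb{Q}}\bigl(u\sigma(V*V)\cap V_m\bigr)=2^{m-1}-\frac1m\sum_{d\mid m}\mu\!\left(\frac md\right)2^d,$$ where the sum runs over the positive divisors $d$ of $m$ and $\mu$ is the Möbius function.
   Context: A multi-index is a nonempty finite sequence $\lambda=(\lambda_1,\ldots,\lambda_p)$ of positive integers, of length $l(\lambda)=p$ and weight $|\lambda|=\sum\lambda_i$. $V$ is the $\mathbb{Q}$-vector space with basis the set of all multi-indices, and $V_m$ (for $m\ge1$) is the subspace spanned by the multi-indices of weight $m$. For multi-indices of the same weight write $\nu\ge\lambda$ if $\nu$ is a refinement of $\lambda$, i.e. $\{\lambda_1+\cdots+\lambda_k:1\le k<l(\lambda)\}\subset\{\nu_1+\cdots+\nu_k:1\le k<l(\nu)\}$. Linear maps $\sigma,u\colon V\to V$ are given by $\sigma(\lambda)=(-1)^{l(\lambda)}\lambda$ and $u(\lambda)=\sum_{\nu\ge\lambda}\nu$. Harmonic product: for multi-indices $\lambda,\nu$, let $\mathcal{H}_{\lambda,\nu}$ be the set of all $2\times l$ matrices $M=(m_{ij})$ ($l\ge1$ arbitrary) with non-negative integer entries such that deleting zeros from the first row gives $\lambda$, deleting zeros from the second row gives $\nu$, and $m_{1j}+m_{2j}>0$ for all $j$. Put $\lambda*\nu=\sum_{M\in\mathcal{H}_{\lambda,\nu}}(m_{11}+m_{21},\ldots,m_{1l}+m_{2l})\in V$, extended bilinearly to $V\times V$. $V*V$ denotes the $\mathbb{Q}$-span of all $v*w$ with $v,w\in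 V$. *)

(* Defs.v *)
From HB Require Import structures.
From mathcomp Require Import all_boot all_order all_algebra finmap.
From mathcomp Require Import boolp classical_sets functions cardinality fsbigop.
From mathcomp.multinomials Require Import monalg.

Set Implicit Arguments.
Unset Strict Implicit.
Unset Printing Implicit Defensive.

Import GRing.Theory.

Local Open Scope classical_set_scope.
Local Open Scope ring_scope.

Definition is_mindex (s : seq nat) : bool := (s != [::]) && (0%N \notin s).

Definition mindex := {s : seq nat | is_mindex s}.

Definition weight (k : mindex) : nat := sumn (val k).

Definition length (k : mindex) : nat := size (val k).

Definition V := {malg rat[mindex]}.

Definition ebasis (k : mindex) : V := << 1 *g k >>.

(* Linear extension to V of a map given on the basis of multi-indices. *)
Definition lin_ext (f : mindex -> V) (v : V) : V :=
  \sum_(k <- msupp v) v@_k *: f k.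

(* The sums lambda_1 + ... + lambda_k for 1 <= k < l(lambda). *)
Definition partial_sums (k : mindex) : seq nat :=
  [seq sumn (take i (val k)) | i <- iota 1 (length k).-1].

Definition refines (n k : mindex) : Prop :=
  weight n = weight k /\ {subset partial_sums k <= partial_sums n}.

Definition sigma : V -> V := lin_ext (fun k => (-1) ^+ length k *: ebasis k).

(* The \sum_(_ \in A) notation is zero on infinite supports; [finite_refines]
   and [finite_harmonic_mx] below show that the index sets are finite. *)
Definition u : V -> V :=
  lin_ext (fun k => \sum_(n \in [set n | refines n k]) ebasis n).

(* A 2 x l matrix with l arbitrary: l is [tag M], the matrix is [tagged M]. *)
Definition mx2 := {l : nat & 'M[nat]_(2, l)}.

Definition row_nz (M : mx2) (i : 'I_2) : seq nat :=
  [seq x <- [seq tagged M i j | j : 'I_(tag M)] | x != 0%N].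

Definition harmonic_mx (k n : mindex) : set mx2 :=
  [set M | [/\ (0 < tag M)%N, row_nz M 0 = val k, row_nz M 1 = val n
           & forall j : 'I_(tag M), (0 < tagged M 0%R j + tagged M 1%R j)%N]].

Definition col_sums (M : mx2) : seq nat :=
  [seq (tagged M 0%R j + tagged M 1%R j)%N | j : 'I_(tag M)].

(* The basis vector of a sequence; the zero case never occurs in [harm_basis],
   see [col_sums_mindex]. *)
Definition basis_vec (s : seq nat) : V :=
  if insub s is Some k then ebasis k else 0.

Definition harm_basis (k n : mindex) : V :=
  \sum_(M \in harmonic_mx k n) basis_vec (col_sums M).

Definition harm (v w : V) : V :=
  \sum_(k <- msupp v) \sum_(n <- msupp w) (v@_k * w@_n) *: harm_basis k n.

Definition lin_span (F : fieldType) (E : lmodType F) (S : set E) : set E :=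
  [set x | exists n (c : 'I_n -> F) (s : 'I_n -> E),
     (forall i, S (s i)) /\ x = \sum_(i < n) c i *: s i].

Definition is_basis (F : fieldType) (E : lmodType F) (S : set E) (n : nat)
    (b : 'I_n -> E) : Prop :=
  (forall c : 'I_n -> F, \sum_(i < n) c i *: b i = 0 -> forall i, c i = 0) /\
  S = lin_span (range b).

(* Dimension of a subspace of a possibly infinite-dimensional space; the value
   is unique by [has_dim_uniq]. *)
Definition has_dim (F : fieldType) (E : lmodType F) (S : set E) (n : nat) :=
  exists b : 'I_n -> E, is_basis S b.

Definition V_ (m : nat) : set V :=
  lin_span [set ebasis k | k in [set k | weight k = m]].

Definition VV : set V := lin_span [set harm v w | v in setT & w in setT].

Definition moebius (n : nat) : int :=
  if all (fun p => logn p n == 1%N) (primes n) then (-1) ^+ size (primes n)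
  else 0.

Lemma lin_extU f k : lin_ext f (ebasis k) = f k.
Proof.
rewrite /lin_ext msuppU oner_eq0 big_seq_fset1 mcoeffUU.
by rewrite scale1r.
Qed.

Lemma lin_extEw f (v : V) (d : {fset mindex}) : (msupp v `<=` d)%fset ->
  lin_ext f v = \sum_(k <- d) v@_k *: f k.
Proof.
move=> sd; apply: big_fset_incl => // k _ kv.
by rewrite mcoeff_outdom // scale0r.
Qed.

Lemma lin_ext_is_linear f : linear (lin_ext f).
Proof.
move=> a v w; pose d := (msupp v `|` msupp w)%fset.
have sv : (msupp v `<=` d)%fset by apply: fsubsetUl.
have sw : (msupp w `<=` d)%fset by apply: fsubsetUr.
have svw : (msupp (a *: v + w) `<=` d)%fset.
  apply: fsubset_trans (msuppD_le _ _) _; apply: fsetSU.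
  exact: msuppZ_le.
rewrite (lin_extEw _ sv) (lin_extEw _ sw) (lin_extEw _ svw).
rewrite scaler_sumr -big_split /=; apply: eq_bigr => k _.
by rewrite mcoeffD mcoeffZ scalerDl scalerA.
Qed.

Lemma harmE v w :
  harm v w = lin_ext (fun k => lin_ext (harm_basis k) w) v.
Proof.
apply: eq_bigr => k _; rewrite scaler_sumr; apply: eq_bigr => n _.
by rewrite scalerA.
Qed.

Lemma harmU k n : harm (ebasis k) (ebasis n) = harm_basis k n.
Proof. by rewrite harmE !lin_extU. Qed.

Lemma leq_mem_sumn (s : seq nat) x : x \in s -> (x <= sumn s)%N.
Proof. by move/perm_to_rem/perm_sumn => -> /=; apply: leq_addr. Qed.

Lemma leq_size_sumn (s : seq nat) : 0%N \notin s -> (size s <= sumn s)%N.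
Proof.
elim: s => //= x s IHs; rewrite inE negb_or eq_sym -lt0n => /andP[x0 /IHs].
by move=> h; rewrite -[(size s).+1]add1n; apply: leq_add.
Qed.

Lemma finite_refines k : finite_set [set n | refines n k].
Proof.
pose N := (weight k).+1.
pose f (t : {l : 'I_N & l.-tuple 'I_N}) : mindex :=
  insubd k (map val (tagged t)).
apply: (@sub_finite_set _ _ (f @` setT)); last first.
  by apply: finite_image; apply: finite_finset.
move=> n [wn _] /=.
have [_ n0] := andP (valP n).
have sn : (size (val n) < N)%N by rewrite ltnS -wn leq_size_sumn.
have st : size (map (@inord (weight k)) (val n)) == Ordinal sn
  by rewrite size_map.
exists (Tagged (fun l : 'I_N => l.-tuple 'I_N) (Tuple st)) => //.
rewrite /f /= -map_comp map_id_in ?valKd // => x xn /=.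
by rewrite inordK // ltnS -wn leq_mem_sumn.
Qed.

Lemma finite_harmonic_mx k n : finite_set (harmonic_mx k n).
Proof.
pose B := (length k + length n).+1; pose C := (weight k + weight n).
pose f (t : {l : 'I_B & 'M['I_C.+1]_(2, l)}) : mx2 :=
  Tagged (fun l => 'M[nat]_(2, l)) (map_mx val (tagged t)).
apply: (@sub_finite_set _ _ (f @` setT)); last first.
  by apply: finite_image; apply: finite_finset.
case=> l M [_ r0 r1 pos].
have lB : (l < B)%N.
  rewrite ltnS /length -r0 -r1 /row_nz /= !size_filter !count_map.
  rewrite -count_predUI -[X in (X <= _)%N]size_enum_ord.
  apply: leq_trans (leq_addr _ _); rewrite -count_predT enumT; apply: sub_count.
  by move=> j _ /=; have := pos j; rewrite -negb_and -addn_eq0 -lt0n.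
have MC i j : (M i j < C.+1)%N.
  rewrite ltnS; have [-> //|nz] := eqVneq (M i j) 0%N.
  have Mr : M i j \in row_nz (Tagged (fun l => 'M[nat]_(2, l)) M) i.
    by rewrite mem_filter nz map_f ?mem_enum.
  case: (unliftP 0 i) Mr => [i'|] -> Mr.
    apply: leq_trans (leq_addl _ _); apply: leq_mem_sumn.
    by rewrite -r1; move: Mr; rewrite ord1; congr (_ \in row_nz _ _);
       apply: val_inj.
  apply: leq_trans (leq_addr _ _); apply: leq_mem_sumn.
  by rewrite -r0.
exists (Tagged (fun l : 'I_B => 'M['I_C.+1]_(2, l))
         (\matrix_(i, j) inord (M i j) : 'M_(2, Ordinal lB))) => //.
rewrite /f /=; congr (Tagged _ _); apply/matrixP => i j; rewrite !mxE.
by rewrite /= inordK.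
Qed.

Lemma col_sums_mindex k n M : harmonic_mx k n M -> is_mindex (col_sums M).
Proof.
case: M => l M [/= l0 _ _ pos]; apply/andP; split.
  by rewrite -size_eq0 size_map size_enum_ord -lt0n.
by apply/mapP => -[j _ /= e]; have := pos j; rewrite -e.
Qed.

Lemma has_dim_leq (F : fieldType) (E : lmodType F) (S : set E) m n :
  has_dim S m -> has_dim S n -> (m <= n)%N.
Proof.
move=> [b [bf ->]] [c [_ bc]].
have hb i : exists p : 'rV[F]_n, b i = \sum_j p 0 j *: c j.
  have : lin_span (range c) (b i).
    rewrite -bc; exists 1%N, (fun=> 1), (fun=> b i); split=> [_|].
      by exists i.
    by rewrite big_ord1 scale1r.
  case=> r [a [s [sc ->]]].
  have [g hg] : {g : 'I_r -> 'I_n & forall l, c (g l) = s l}.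
    apply: (@choice _ _ (fun l j => c j = s l)) => l.
    by have [j _ <-] := sc l; exists j.
  exists (\sum_l a l *: delta_mx 0 (g l)).
  under [RHS]eq_bigr do rewrite summxE scaler_suml.
  rewrite exchange_big; apply: eq_bigr => l _ /=.
  rewrite -hg.
  rewrite (bigD1 (g l)) //= !mxE !eqxx mulr1 big1 ?addr0 // => j /negPf jg.
  by rewrite !mxE jg andbF mulr0 scale0r.
have [P hP] := choice hb.
pose A := \matrix_(i < m, j < n) P i 0 j.
suff /eqP <- : row_free A by apply: rank_leq_col.
rewrite -kermx_eq0; apply/eqP/row_matrixP => i; rewrite row0.
have : row i (kermx A) *m A = 0 by rewrite -row_mul mulmx_ker row0.
move: (row i _) => w wA; apply/rowP => j; rewrite mxE.
apply: (bf (fun j => w 0 j)).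
under eq_bigr do rewrite hP scaler_sumr.
rewrite exchange_big big1 //= => l _.
under eq_bigr do rewrite scalerA.
rewrite -scaler_suml; have /rowP/(_ l) := wA; rewrite !mxE.
under eq_bigr do rewrite mxE.
by move=> ->; rewrite scale0r.
Qed.

Lemma has_dim_uniq (F : fieldType) (E : lmodType F) (S : set E) m n :
  has_dim S m -> has_dim S n -> m = n.
Proof.
by move=> hm hn; apply/eqP; rewrite eqn_leq !(has_dim_leq hm hn, has_dim_leq hn hm).
Qed.

(* Main.v *)
(** Encode a word as the binary number 1 0^(a1 - 1) 1 0^(a2 - 1) ..., so that
    concatenation acts as u, v |-> u 2^|v| + v, and let the slope of a word be
    this number divided by 2^|w| - 1. The slope of a concatenation is a weighted
    mean of the slopes of its parts, so the words whose slope increases along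
    every splitting play the role of Lyndon words: every word is a unique
    concatenation of Lyndon words of nonincreasing slopes. If s is the shortest
    suffix of w = p s of minimal slope, an Abel summation shows that w is the
    term of p * s with the largest binary code. Hence the harmonic products of
    Lyndon words span V_m, and by uniqueness of the factorization there are only
    2^(m-1) of them, so they form a basis and V * V is spanned by those with at
    least two factors. Since u sigma is graded and injective, only the number of
    Lyndon words of weight m is left: counting the factors in all factorizations
    gives sum_(d | m) d L_d = 2^m - 1, which is solved by Moebius inversion. *)

From HB Require Import structures.
Require Import Defs.
From mathcomp Require Import all_boot all_order all_algebra finmap.
From mathcomp Require Import boolp classical_sets functions cardinality fsbigop.
From mathcomp.multinomials Require Import monalg.
From mathcomp Require Import zify ring.

Set Implicit Arguments.
Unset Strict Implicit.
Unset Printing Implicit Defensive.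

Import Order.TTheory GRing.Theory Num.Theory.

Local Open Scope classical_set_scope.
Local Open Scope ring_scope.

(** * Binary codes and slopes of words *)

(* [(2 ^ a)./2] is 2 ^ (a - 1), except that it is 0 for a = 0: zero letters do
   not count. *)
Fixpoint bnum (w : seq nat) : nat :=
  if w is a :: w' then ((2 ^ a)./2 * 2 ^ sumn w' + bnum w')%N else 0%N.

Definition slope (w : seq nat) : rat := (bnum w)%:R / (2 ^+ sumn w - 1).

(** The numerator of [slope w - c]: its sign compares the slope with [c], and it stays additive
    under concatenation up to powers of 2, which the slope does not. *)
Definition excess (c : rat) (w : seq nat) : rat :=
  (bnum w)%:R - c * (2 ^+ sumn w - 1).

Lemma mindex_cat u v : u != [::] -> v != [::] ->
  is_mindex (u ++ v) = is_mindex u && is_mindex v.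
Proof.
by rewrite /is_mindex mem_cat negb_or -!size_eq0 size_cat; case: u v => [|a u] [].
Qed.

Lemma mindex_sumn w : is_mindex w -> (0 < sumn w)%N.
Proof. by case: w => [|[|a] w] //= /andP[_]. Qed.

Lemma bnum_cat u v : bnum (u ++ v) = (bnum u * 2 ^ sumn v + bnum v)%N.
Proof. by elim: u => //= a u ->; rewrite sumn_cat expnD; ring. Qed.

Lemma bnum_lt w : (0%N \notin w) -> (bnum w < 2 ^ sumn w)%N.
Proof.
elim: w => // -[//|a] w IH; rewrite inE negb_or => /andP[_ /IH] /=.
rewrite expnS mul2n doubleK expnD expnS => ?.
by have: (0 < 2 ^ a)%N; rewrite ?expn_gt0 //; nia.
Qed.

Lemma bnum_ge w : is_mindex w -> (2 ^ (sumn w).-1 <= bnum w)%N.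
Proof.
case: w => [|[|a] w] //; rewrite /is_mindex /= => _.
by rewrite expnS mul2n doubleK -expnD leq_addr.
Qed.

(** The code of a word of weight n without zero letters has exactly n binary digits. *)
Lemma bnum_sumn u v : 0%N \notin u -> 0%N \notin v -> bnum u = bnum v ->
  sumn u = sumn v.
Proof.
have main u' v' : 0%N \notin u' -> 0%N \notin v' -> bnum u' = bnum v' ->
  (sumn u' <= sumn v')%N.
  move=> u0 v0 e; case: (eqVneq u' [::]) => [->//|un].
  have mu : is_mindex u' by rewrite /is_mindex un.
  have := leq_ltn_trans (bnum_ge mu); rewrite e => /(_ _ (bnum_lt v0)).
  by rewrite ltn_exp2l //; have := mindex_sumn mu; lia.
by move=> u0 v0 e; apply/eqP; rewrite eqn_leq !main.
Qed.

(** Equal codes force equal weights, so the leading powers of 2 cancel and leave the codes of the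
    tails; the first letters then agree by weight. *)
Lemma bnum_inj u v : 0%N \notin u -> 0%N \notin v -> bnum u = bnum v -> u = v.
Proof.
elim: u v => [|a u IH] [|b v] //.
- by move=> _ v0 e; have := bnum_ge (v0 : is_mindex (b :: v)); rewrite -e leqn0 expn_eq0.
- by move=> u0 _ e; have := bnum_ge (u0 : is_mindex (a :: u)); rewrite e leqn0 expn_eq0.
move=> u0 v0 e; have es := bnum_sumn u0 v0 e; move: u0 v0 e.
rewrite !inE !negb_or => /andP[a0 u0] /andP[b0 v0] /=.
case: a b a0 b0 es => [|a] [|b] // _ _ es.
have hs : (a + sumn u = b + sumn v)%N by move: es => /=; lia.
rewrite !expnS !mul2n !doubleK -!expnD hs => /eqP; rewrite eqn_add2l => /eqP /(IH _ u0 v0) euv.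
by rewrite euv; congr (_ :: _); move: es; rewrite /= euv; lia.
Qed.

Lemma excess_cat c u v :
  excess c (u ++ v) = excess c u * 2 ^+ sumn v + excess c v.
Proof.
rewrite /excess bnum_cat sumn_cat natrD natrM natrX exprD; ring.
Qed.

Lemma den_gt0 w : is_mindex w -> 0 < 2 ^+ sumn w - 1 :> rat.
Proof.
by move=> /mindex_sumn w0; rewrite subr_gt0 exprn_egt1 //; lia.
Qed.

Lemma slope_ge c w : is_mindex w -> (c <= slope w) = (0 <= excess c w).
Proof. by move=> /den_gt0 w0; rewrite /slope ler_pdivlMr // subr_ge0. Qed.

Lemma slope_gt c w : is_mindex w -> (c < slope w) = (0 < excess c w).
Proof. by move=> /den_gt0 w0; rewrite /slope ltr_pdivlMr // subr_gt0. Qed.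

Lemma slope_le c w : is_mindex w -> (slope w <= c) = (excess c w <= 0).
Proof. by move=> /den_gt0 w0; rewrite /slope ler_pdivrMr // subr_le0. Qed.

Lemma excess_slope w : is_mindex w -> excess (slope w) w = 0.
Proof.
move=> w0; apply/eqP; rewrite eq_le -slope_le // -slope_ge //.
by rewrite lexx.
Qed.

Lemma pow2_gt0 n : 0 < 2 ^+ n :> rat.
Proof. exact: exprn_gt0. Qed.

Lemma slope_cat_ge c u v : is_mindex u -> is_mindex v ->
  c <= slope u -> c <= slope v -> c <= slope (u ++ v).
Proof.
move=> hu hv; have hun : u != [::] by case/andP: hu.
have hvn : v != [::] by case/andP: hv.
rewrite !slope_ge ?mindex_cat ?hu ?hv // excess_cat => eu ev.
by rewrite addr_ge0 // mulr_ge0 // ltW // pow2_gt0.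
Qed.

(* Mediant property: [slope (u ++ v)] is a convex combination of the two slopes,
   so comparing it with one of them compares the two. *)
Lemma slope_suffix_le_cat u v : is_mindex u -> is_mindex v ->
  (slope v <= slope (u ++ v)) = (slope v <= slope u).
Proof.
move=> hu hv; have hun : u != [::] by case/andP: hu.
have hvn : v != [::] by case/andP: hv.
rewrite !slope_ge ?mindex_cat ?hu ?hv // excess_cat excess_slope //.
by rewrite addr0 pmulr_lge0 // pow2_gt0.
Qed.

Lemma slope_cat_lt_suffix u v : is_mindex u -> is_mindex v ->
  (slope (u ++ v) < slope v) = (slope u < slope v).
Proof. by move=> hu hv; rewrite !ltNge slope_suffix_le_cat. Qed.

Lemma slope_prefix_lt_cat u v : is_mindex u -> is_mindex v ->
  (slope u < slope (u ++ v)) = (slope u < slope v).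
Proof.
move=> hu hv; have hun : u != [::] by case/andP: hu.
have hvn : v != [::] by case/andP: hv.
by rewrite !slope_gt ?mindex_cat ?hu ?hv // excess_cat excess_slope // mul0r add0r.
Qed.

(** A word of slope c has code c (2 ^ |w| - 1), and so has a concatenation of two such words. Both
    orders therefore have the same code, and [bnum_inj] applies. *)
Lemma slope_catC u v : is_mindex u -> is_mindex v -> slope u = slope v ->
  u ++ v = v ++ u.
Proof.
move=> hu hv e.
have hun : u != [::] by case/andP: hu.
have hvn : v != [::] by case/andP: hv.
apply: bnum_inj; rewrite ?mem_cat ?negb_or.
- by case/andP: hu => _ ->; case/andP: hv.
- by case/andP: hu => _ ->; case/andP: hv => _ ->.
have := excess_slope hu; have := excess_slope hv; rewrite e /excess.
move=> /eqP; rewrite subr_eq0 => /eqP ev /eqP; rewrite subr_eq0 => /eqP eu.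
apply/eqP; rewrite -(eqr_nat rat) !bnum_cat !natrD !natrM !natrX ev eu; apply/eqP.
ring.
Qed.

(** * Lyndon words with respect to the slope *)

Definition lyndon (w : seq nat) : bool :=
  is_mindex w &&
  all (fun i => slope (take i w) < slope (drop i w)) (iota 1 (size w).-1).

Lemma lyndonP w : reflect
  (is_mindex w /\ forall u v, w = u ++ v -> u != [::] -> v != [::] ->
     slope u < slope v) (lyndon w).
Proof.
apply: (iffP andP) => -[hw h]; split=> //.
  move=> u v e un vn; move: h => /allP/(_ (size u)).
  rewrite e take_size_cat // drop_size_cat //; apply; rewrite mem_iota size_cat.
  move: un vn; rewrite -!size_eq0; case: (size u) (size v) => [|a] [|b] //= _ _; lia.
apply/allP => i; rewrite mem_iota add1n => /andP[i0 hi].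
have hiw : (i < size w)%N by case: (size w) hi => [|k] //=; rewrite ltnS leqNgt; lia.
apply: h; rewrite ?cat_take_drop // -size_eq0 ?size_takel ?size_drop //.
  by rewrite -lt0n.
  exact: ltnW.
by rewrite subn_eq0 -ltnNge.
Qed.

Lemma lyndon_mindex w : lyndon w -> is_mindex w.
Proof. by case/andP. Qed.

Lemma lyndon_suffix u v : lyndon (u ++ v) -> u != [::] -> v != [::] ->
  slope (u ++ v) < slope v.
Proof.
move=> /lyndonP[+ h] un vn; rewrite mindex_cat // => /andP[hu hv].
by rewrite slope_cat_lt_suffix //; apply: h.
Qed.

(** Words of equal slope commute, so the shorter is a prefix of the longer. If it were a proper
    prefix, the Lyndon property and the mediant property would make its slope strictly smaller. *)
Lemma lyndon_slope_inj u v : lyndon u -> lyndon v -> slope u = slope v -> u = v.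
Proof.
wlog le_uv : u v / (size u <= size v)%N.
  by move=> hw hu hv e; case: (leqP (size u) (size v)) => [/hw|/ltnW /hw h];
    [apply | apply/esym/h].
move=> hu hv e; have := slope_catC (lyndon_mindex hu) (lyndon_mindex hv) e.
move=> /(congr1 (take (size u))); rewrite take_size_cat // takel_cat // => eu.
have evu := cat_take_drop (size u) v; rewrite -eu in evu.
case: (eqVneq (drop (size u) v) [::]) => [d0|dn]; first by rewrite -evu d0 cats0.
have un : u != [::] by case/andP: (lyndon_mindex hu).
move: (hv); rewrite -evu => /lyndonP[+ /(_ _ _ erefl un dn)].
rewrite mindex_cat // => /andP[mu md].
by rewrite -slope_prefix_lt_cat // evu e ltxx.
Qed.

(** * Lyndon factorization *)

Definition ge_slope : rel (seq nat) := fun u v => slope v <= slope u.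

Lemma ge_slope_trans : transitive ge_slope.
Proof. by move=> v u w uv vw; apply: le_trans vw uv. Qed.

Lemma ge_slope_total : total ge_slope.
Proof. by move=> u v; apply: le_total. Qed.

(** The Chen-Fox-Lyndon condition, with slopes in place of the lexicographic order. *)
Definition cfl (L : seq (seq nat)) : bool := all lyndon L && sorted ge_slope L.

(** When a letter is prepended, either the whole word becomes the new strict minimum, and then it is
    Lyndon because all its proper suffixes have larger slope, or the old suffix remains minimal. *)
Lemma min_slope_suffix w : is_mindex w -> exists p s,
  [/\ w = p ++ s, lyndon s
    & forall u v, w = u ++ v -> v != [::] -> slope s <= slope v].
Proof.
elim: w => // a w IH haw.
case: (eqVneq w [::]) => [w0|wn].
  exists [::], [:: a]; split; [by rewrite w0|by rewrite /lyndon -{1}w0 haw|].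
  by rewrite w0 => -[|x u] v /=; [move=> <-|case=> _; case: u v => [|? ?] []].
have hw : is_mindex w by move: haw; rewrite -cat1s mindex_cat // => /andP[].
have [p [s [ew hs hmin]]] := IH hw.
(* On a tie the shorter suffix [s] is kept: the whole word would not be Lyndon. *)
case: (ltP (slope (a :: w)) (slope s)) => h; last first.
  exists (a :: p), s; split; rewrite ?ew // => -[|x u] v /=.
    by move=> <- _; rewrite -ew.
  by case=> _; rewrite -ew; apply: hmin.
exists [::], (a :: w); split=> //.
  apply/lyndonP; split=> // -[|x u] v // e _ vn.
  move: (haw); rewrite e mindex_cat // => /andP[hu hv].
  rewrite -slope_cat_lt_suffix // -e; apply: lt_le_trans h _.
  by case: e => _; move=> /hmin; apply.
move=> [|x u] v /=; first by move=> <-.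
by case=> _ /hmin h' /h'; apply: le_trans (ltW h).
Qed.

(** Strong induction on the length, splitting off the Lyndon suffix of minimal slope as the last
    factor. *)
Lemma cfl_exists w : 0%N \notin w -> exists2 L, cfl L & flatten L = w.
Proof.
have [n] := ubnP (size w); elim: n w => // n IH w hn w0.
case: (eqVneq w [::]) => [->|wn]; first by exists [::].
have hw : is_mindex w by rewrite /is_mindex wn.
have [p [s [ew hs hmin]]] := min_slope_suffix hw.
have sn : s != [::] by case/andP: (lyndon_mindex hs).
have [||L hL eL] := IH p.
- by move: hn; rewrite ew size_cat -addnS; move: sn; rewrite -size_eq0; lia.
- by move: w0; rewrite ew mem_cat negb_or => /andP[].
exists (rcons L s); last by rewrite flatten_rcons eL ew.
case/andP: hL => aL sL; rewrite /cfl all_rcons hs aL /=.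
case/lastP: L aL sL eL => // L l; rewrite all_rcons => /andP[hl _] sL.
rewrite flatten_rcons => eL.
have -> : sorted ge_slope (rcons (rcons L l) s) = ge_slope l s.
  case: L sL {eL} => [|x L] /=; first by rewrite andbT.
  by rewrite [path _ x (rcons (rcons _ _) _)]rcons_path last_rcons => ->.
(* By the mediant property it is enough to compare [s] with [l ++ s], which is a suffix of [w], so
   minimality of [s] applies. *)
rewrite /ge_slope -slope_suffix_le_cat ?lyndon_mindex //.
apply: (hmin (flatten L)); first by rewrite ew -eL catA.
by rewrite -size_eq0 size_cat addn_eq0 !size_eq0 negb_and sn orbT.
Qed.

Lemma flatten_mindex L : all lyndon L -> L != [::] -> is_mindex (flatten L).
Proof.
elim: L => // l L IH /= /andP[hl hL] _.
have ln : l != [::] by case/andP: (lyndon_mindex hl).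
case: (eqVneq L [::]) => [->|Ln]; first by rewrite cats0 lyndon_mindex.
have := IH hL Ln => hF; rewrite mindex_cat //; last by case/andP: hF.
by rewrite lyndon_mindex.
Qed.

(** A suffix that cuts the first factor [x] is a suffix [t] of [x] followed by the remaining factors
    [F]. The slope of [t] is at least that of [x], hence at least that of [l]; the same bound holds
    for [F] by induction, and concatenation preserves it. *)
Lemma cfl_last_min L l u v : cfl (rcons L l) -> flatten (rcons L l) = u ++ v ->
  v != [::] -> slope l <= slope v.
Proof.
elim: L u v => [|x L IH] u v.
  rewrite /cfl /= cats0 !andbT => hl e vn; case: (eqVneq u [::]) => [u0|un].
    by rewrite e u0.
  by move: hl; rewrite e => /lyndon_suffix h; apply/ltW/h.
rewrite /cfl rcons_cons /= => /andP[/andP[hx hL] pL] e vn.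
have hc : cfl (rcons L l) by rewrite /cfl hL (path_sorted pL).
set F := flatten _ in IH e.
have hF : is_mindex F by apply: flatten_mindex => //; case: (L).
have Fn : F != [::] by case/andP: hF.
case: (leqP (size x) (size u)) => hxu.
  have := congr1 (drop (size x)) e; rewrite drop_size_cat // drop_cat.
  case: ltngtP hxu => // hxu _; first by move=> /(IH _ _ hc)/(_ vn).
  by rewrite hxu subnn drop0 => /(IH [::] _ hc)/(_ vn).
have ex : x = u ++ drop (size u) x.
  by rewrite -{1}(cat_take_drop (size u) x); congr (_ ++ _);
     have := congr1 (take (size u)) e; rewrite takel_cat ?(ltnW hxu) // (@take_size_cat _ _ u).
set t := drop _ _ in ex.
have tn : t != [::] by rewrite -size_eq0 size_drop subn_eq0 -ltnNge.
have ev : v = t ++ F.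
  have := congr1 (drop (size u)) e; rewrite (@drop_size_cat _ _ u) // => <-.
  by rewrite drop_cat hxu.
have ht : is_mindex t.
  move: (lyndon_mindex hx); rewrite ex /is_mindex mem_cat negb_or => /andP[_ /andP[_ ->]].
  by rewrite tn.
rewrite ev slope_cat_ge //; last by apply: (IH [::]).
apply: (@le_trans _ _ (slope x)).
  by have := order_path_min ge_slope_trans pL; rewrite all_rcons => /andP[].
case: (eqVneq u [::]) => [u0|un]; first by rewrite {1}ex u0.
by move: (hx); rewrite ex => /lyndon_suffix h; apply/ltW/h.
Qed.

(** Each last factor is a suffix of the common word, so by minimality the two have the same slope
    and are equal. Removing them allows induction. *)
Lemma cfl_inj L K : cfl L -> cfl K -> flatten L = flatten K -> L = K.
Proof.
have nilF M : cfl M -> flatten M = [::] -> M = [::].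
  case/andP=> aM _ e; apply/eqP/negPn/negP => Mn.
  by have := flatten_mindex aM Mn; rewrite e.
elim/last_ind: L K => [|L l IH] K hL hK e; first by apply/esym/nilF.
case/lastP: K => [|K k] in hK e *; first by apply: nilF.
have nl : l != [::] by move: hL; rewrite /cfl all_rcons =>
  /andP[/andP[/lyndon_mindex/andP[]]].
have nk : k != [::] by move: hK; rewrite /cfl all_rcons =>
  /andP[/andP[/lyndon_mindex/andP[]]].
have lk : l = k.
  apply: lyndon_slope_inj.
  - by move: hL; rewrite /cfl all_rcons => /andP[/andP[]].
  - by move: hK; rewrite /cfl all_rcons => /andP[/andP[]].
  apply/le_anti/andP; split.
    by apply: (cfl_last_min hL _ nk); rewrite e flatten_rcons.
  by apply: (cfl_last_min hK _ nl); rewrite -e flatten_rcons.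
have cflr M x : cfl (rcons M x) -> cfl M.
  rewrite /cfl all_rcons => /andP[/andP[_ ->]] /=.
  by rewrite -cats1 => /cat_sorted2[].
move: e; rewrite lk !flatten_rcons => e.
have sz : size (flatten L) = size (flatten K).
  by have := congr1 size e; rewrite !size_cat => /addIn.
move/eqP: e; rewrite eqseq_cat // => /andP[/eqP e _].
by rewrite (IH K) ?(cflr _ _ hL) ?(cflr _ _ hK).
Qed.

(** * Columns of the harmonic product *)

(* The 2 x l matrices of the harmonic product, as lists of columns. *)
Fixpoint cols (x y : seq nat) {struct x} : seq (seq (nat * nat)) :=
  if x is a :: x' then
    (fix cols_x y := if y is b :: y' then
       [seq (a, 0%N) :: c | c <- cols x' y] ++
       [seq (0%N, b) :: c | c <- cols_x y'] ++
       [seq (a, b) :: c | c <- cols x' y']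
     else [:: [seq (i, 0%N) | i <- x]]) y
  else [:: [seq (0%N, j) | j <- y]].

Definition colsum (c : seq (nat * nat)) : seq nat := [seq (e.1 + e.2)%N | e <- c].

Definition nonzeros (w : seq nat) : seq nat := [seq i <- w | i != 0%N].

Lemma cols_cons a x b y : cols (a :: x) (b :: y) =
  [seq (a, 0%N) :: c | c <- cols x (b :: y)] ++
  [seq (0%N, b) :: c | c <- cols (a :: x) y] ++
  [seq (a, b) :: c | c <- cols x y].
Proof. by []. Qed.

Lemma colsx0 x : cols x [::] = [:: [seq (i, 0%N) | i <- x]].
Proof. by case: x. Qed.

Lemma nonzeros_id w : 0%N \notin w -> nonzeros w = w.
Proof.
by move=> w0; apply/all_filterP/allP => i; apply: contraTneq => ->.
Qed.

Lemma bnum_nonzeros w : bnum (nonzeros w) = bnum w.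
Proof.
have sn v : sumn (nonzeros v) = sumn v by elim: v => // -[|a] v //= ->.
by elim: w => // -[|a] w //= IH; rewrite ?sn IH.
Qed.

Lemma sumn_nonzeros w : sumn (nonzeros w) = sumn w.
Proof. by elim: w => // -[|a] w //= ->. Qed.

Lemma mem_map_cons (T : eqType) (e f : T) c s :
  (f :: c \in [seq e :: d | d <- s]) = (f == e) && (c \in s).
Proof.
apply/mapP/andP => [[d ds [-> ->]]|[/eqP-> cs]]; first by rewrite eqxx.
by exists c.
Qed.

Lemma nil_map_cons (T : eqType) (e : T) s : ([::] \in [seq e :: d | d <- s]) = false.
Proof. by apply/negP => /mapP[]. Qed.

Lemma notin0_cons a x : 0%N \notin a :: x -> a != 0%N /\ 0%N \notin x.
Proof. by rewrite inE negb_or eq_sym => /andP[]. Qed.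

(** Matches the recursive enumeration with the conditions that define the matrices of the harmonic
    product. *)
Lemma mem_cols x y c : 0%N \notin x -> 0%N \notin y ->
  (c \in cols x y) = [&& nonzeros (map fst c) == x, nonzeros (map snd c) == y
                       & (0%N, 0%N) \notin c].
Proof.
elim: c x y => [|[i j] c IH] [|a x] [|b y] x0 y0.
- by [].
- by rewrite inE.
- by rewrite inE.
- by rewrite cols_cons !mem_cat !nil_map_cons.
- by rewrite inE /=; case: i j => [|i] [|j] //=; rewrite ?inE ?andbF.
- have [b0 y0'] := notin0_cons y0.
  have := IH [::] y isT y0'; rewrite /= !inE eqseq_cons xpair_eqE => ->.
  by case: i j => [|i] [|j] //=;
    rewrite ?eqseq_cons ?andbF //= ?(negPf b0) ?(eq_sym 0%N) ?(negPf b0) //;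
    do ?case: (_ == _) => //.
- have [a0 x0'] := notin0_cons x0.
  have := IH x [::] x0' isT; rewrite colsx0 /= !inE eqseq_cons xpair_eqE => ->.
  by case: i j => [|i] [|j] //=;
    rewrite ?eqseq_cons ?andbF //= ?(negPf a0) ?(eq_sym 0%N) ?(negPf a0) //;
    do ?case: (_ == _) => //.
have [a0 x0'] := notin0_cons x0.
have [b0 y0'] := notin0_cons y0.
rewrite cols_cons !mem_cat !mem_map_cons !IH // !xpair_eqE inE xpair_eqE /=.
case: i j => [|i] [|j] //=;
  rewrite ?eqseq_cons ?andbF ?(eq_sym 0%N) ?(negPf a0) ?(negPf b0) ?andbF ?orbF
    ?andbT //=.
all: by do ?case: (_ == _).
Qed.

Lemma cols_uniq x y : 0%N \notin x -> 0%N \notin y -> uniq (cols x y).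
Proof.
have cI (T : eqType) (e : T) : injective (cons e) by move=> ? ? [].
elim: x y => [|a x IHx] //; elim=> [|b y IHy] // x0 y0.
have [a0 x0'] := notin0_cons x0.
have [b0 y0'] := notin0_cons y0.
rewrite cols_cons !cat_uniq !map_inj_uniq; do ?exact: cI.
rewrite !IHx // IHy // !andTb andbT; apply/andP; split; apply/hasPn => c.
  rewrite mem_cat => /orP[] /mapP[d _ ->]; rewrite mem_map_cons xpair_eqE.
    by rewrite eq_sym (negPf a0).
  by rewrite (negPf b0) andbF.
by move=> /mapP[d _ ->]; rewrite mem_map_cons xpair_eqE (negPf a0).
Qed.

(** * Bounding the codes of the terms of a product *)

Lemma sumn_colsum c : sumn (colsum c) = (sumn (map fst c) + sumn (map snd c))%N.
Proof. by elim: c => //= e c ->; lia. Qed.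

Lemma colsum_neq0 c : (0%N, 0%N) \notin c -> 0%N \notin colsum c.
Proof.
apply: contra => /mapP[[i j] ij /= e].
by move: ij; have [-> ->] : i = 0%N /\ j = 0%N by lia.
Qed.

(** [row1_excess] and [row2_excess] add up to the excess of the word in which every column (a, b) is
    written as a followed by b; each collects the contributions of one row. *)
Fixpoint row1_excess (r : rat) (c : seq (nat * nat)) : rat :=
  if c is e :: c' then
    excess r [:: e.1] * 2 ^+ (e.2 + sumn (colsum c')) + row1_excess r c'
  else 0.

Fixpoint row2_excess (r : rat) (c : seq (nat * nat)) : rat :=
  if c is e :: c' then
    excess r [:: e.2] * 2 ^+ sumn (colsum c') + row2_excess r c'
  else 0.

Lemma excess_nil r : excess r [::] = 0.
Proof. by rewrite /excess expr0 subrr mulr0 subrr. Qed.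

Lemma excess_cons r a w : excess r (a :: w) = excess r [:: a] * 2 ^+ sumn w + excess r w.
Proof. by rewrite -cat1s excess_cat. Qed.

(* A merged column (a, b) weighs less than the letter a followed by b. *)
Lemma excess_colsum r c : excess r (colsum c) <= row1_excess r c + row2_excess r c.
Proof.
elim: c => [|[a b] c IH]; first by rewrite excess_nil addr0.
rewrite [colsum _]/= excess_cons /= addrACA; apply: lerD IH.
rewrite exprD mulrA -mulrDl ler_pM2r ?pow2_gt0 //.
rewrite /excess /= !addn0 !muln1 exprD.
have -> : (((2 ^ a)./2)%:R - r * (2 ^+ a - 1)) * 2 ^+ b +
    (((2 ^ b)./2)%:R - r * (2 ^+ b - 1)) =
    ((2 ^ a)./2 * 2 ^ b + (2 ^ b)./2)%:R - r * (2 ^+ a * 2 ^+ b - 1) :> rat.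
  by rewrite natrD natrM natrX; ring.
(* For positive [a], half of 2 ^ (a + b) is half of 2 ^ a times 2 ^ b, so the separate letter [b]
   gives a nonnegative surplus. For [a] = 0 both sides agree. *)
rewrite lerD2r ler_nat; case: a => [|a] /=; first by rewrite add0n mul0n add0n.
by rewrite addSn !expnS !mul2n !doubleK -expnD leq_addr.
Qed.

(** Abel summation from the left: moving a letter of the second row to the right of the first row
    multiplies the excess of a suffix of the first row, which is nonnegative, by a power of 2. *)
Lemma row1_excess_le r c :
  (forall u v, map fst c = u ++ v -> 0 <= excess r v) ->
  row1_excess r c <= excess r (map fst c) * 2 ^+ sumn (map snd c).
Proof.
elim: c => [|[a b] c IH] h /=; first by rewrite excess_nil mul0r.
have hc u v : map fst c = u ++ v -> 0 <= excess r v.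
  by move=> e; apply: (h (a :: u)); rewrite /= e.
rewrite (excess_cons r a (map fst c)) [leRHS]mulrDl sumn_colsum.
rewrite -(mulrA (excess r [:: a])) -exprD addnCA.
rewrite lerD2l; apply: le_trans (IH hc) _.
by rewrite ler_wpM2l ?(hc [::]) // ler_eXn2l // ?leq_addl // ltr1n.
Qed.

(** The dual Abel summation, from the right: removing a letter of the first row divides the excess
    of a prefix of the second row, which is nonpositive, by a power of 2. *)
Lemma row2_excess_le r c :
  (forall u v, map snd c = u ++ v -> excess r u <= 0) ->
  row2_excess r c <= excess r (map snd c).
Proof.
have rc t e : row2_excess r (rcons t e) =
    row2_excess r t * 2 ^+ (e.1 + e.2) + excess r [:: e.2].
  elim: t => [|f t IH] /=; first by rewrite expr0 mulr1 mul0r addr0 add0r.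
  rewrite IH /colsum map_rcons sumn_rcons exprD.
  by move: (excess r _) (excess r _) => E E'; ring.
elim/last_ind: c => [|c [a b] IH] h; first by rewrite excess_nil.
have hc u v : map snd c = u ++ v -> excess r u <= 0.
  by move=> e; apply: (h u (rcons v b)); rewrite map_rcons e rcons_cat.
rewrite rc map_rcons -cats1 excess_cat /= addn0 lerD2r.
apply: (@le_trans _ _ (excess r (map snd c) * 2 ^+ (a + b))).
  by rewrite ler_pM2r ?pow2_gt0 // IH.
rewrite ler_wnM2l //; first by apply: (hc _ [::]); rewrite cats0.
by rewrite ler_eXn2l // ?leq_addl // ltr1n.
Qed.

Lemma nonzeros_cat_suffix w p u v : nonzeros w = p -> w = u ++ v ->
  p = nonzeros u ++ nonzeros v.
Proof. by move=> <- ->; rewrite /nonzeros filter_cat. Qed.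

Lemma excess_nonzeros r w : excess r (nonzeros w) = excess r w.
Proof. by rewrite /excess bnum_nonzeros sumn_nonzeros. Qed.

(** The three excess inequalities combine to show that plain concatenation has the largest code
    among all terms of [p] * [s]. *)
Lemma bnum_cols_le r p s c :
  (forall u v, p = u ++ v -> 0 <= excess r v) ->
  (forall u v, s = u ++ v -> excess r u <= 0) ->
  nonzeros (map fst c) = p -> nonzeros (map snd c) = s ->
  (bnum (colsum c) <= bnum (p ++ s))%N.
Proof.
move=> hp hs ep es.
have es1 : sumn (map fst c) = sumn p by rewrite -ep sumn_nonzeros.
have es2 : sumn (map snd c) = sumn s by rewrite -es sumn_nonzeros.
have h : excess r (colsum c) <= excess r (p ++ s).
  apply: le_trans (excess_colsum r c) _; rewrite excess_cat lerD //.
    rewrite -ep excess_nonzeros -es2; apply: row1_excess_le => u v e.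
    by rewrite -excess_nonzeros (hp (nonzeros u)) // (nonzeros_cat_suffix ep e).
  rewrite -es excess_nonzeros; apply: row2_excess_le => u v e.
  by rewrite -excess_nonzeros (hs _ (nonzeros v)) // (nonzeros_cat_suffix es e).
(* Both words have the same weight, so comparing excesses amounts to comparing codes. *)
move: h; rewrite /excess sumn_colsum es1 es2 sumn_cat lerD2r ler_nat; exact.
Qed.

(** * The harmonic algebra *)

Section QuasiShuffleSum.
Variable Z : nmodType.
Implicit Types (x y z w : seq nat) (G : seq nat -> Z).

(** The arbitrary [G] makes induction possible: the first letter of each term is absorbed into
    [G]. *)
Definition qsum x y G : Z := \sum_(c <- cols x y) G (colsum c).

Lemma qsum0y y G : qsum [::] y G = G y.
Proof. by rewrite /qsum big_seq1 /colsum -map_comp map_id. Qed.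

Lemma qsumx0 x G : qsum x [::] G = G x.
Proof.
rewrite /qsum colsx0 big_seq1 /colsum -map_comp.
by rewrite (eq_map (_ : _ =1 id)) ?map_id // => i /=; rewrite addn0.
Qed.

Lemma qsum_cons a x b y G : qsum (a :: x) (b :: y) G =
  qsum x (b :: y) (fun w => G (a :: w)) +
  (qsum (a :: x) y (fun w => G (b :: w)) +
   qsum x y (fun w => G ((a + b)%N :: w))).
Proof. by rewrite /qsum cols_cons !big_cat !big_map /= addn0. Qed.

Lemma eq_qsum x y G H : G =1 H -> qsum x y G = qsum x y H.
Proof. by move=> e; apply: eq_bigr. Qed.

Lemma qsumD x y G H : qsum x y (fun w => G w + H w) = qsum x y G + qsum x y H.
Proof. exact: big_split. Qed.

Lemma qsumC x y G : qsum x y G = qsum y x G.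
Proof.
elim: x y G => [|a x IHx] y G; first by rewrite qsum0y qsumx0.
elim: y G => [|b y IHy] G; first by rewrite qsum0y qsumx0.
by rewrite !qsum_cons IHx IHy IHx addrCA addnC.
Qed.

Lemma qsumA x y z G :
  qsum x y (fun w => qsum w z G) = qsum y z (fun w => qsum x w G).
Proof.
elim: x y z G => [|a x IHx] y z G.
  by rewrite qsum0y; apply: eq_qsum => w; rewrite qsum0y.
elim: y z G => [|b y IHy] z G; first by rewrite qsumx0 qsum0y.
elim: z G => [|c z IHz] G.
  by rewrite qsumx0; apply: eq_qsum => w; rewrite qsumx0.
(* Seven sums, one for each nonempty set of words among the three that contribute to the first
   letter; [Er] is the same expansion of the other bracketing. *)
have El : qsum (a :: x) (b :: y) (fun w => qsum w (c :: z) G) =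
    qsum x (b :: y) (fun w => qsum w (c :: z) (fun t => G (a :: t))) +
    qsum (a :: x) y (fun w => qsum w (c :: z) (fun t => G (b :: t))) +
    qsum x y (fun w => qsum w (c :: z) (fun t => G ((a + b)%N :: t))) +
    qsum (a :: x) (b :: y) (fun w => qsum w z (fun t => G (c :: t))) +
    (qsum x (b :: y) (fun w => qsum w z (fun t => G ((a + c)%N :: t))) +
     qsum (a :: x) y (fun w => qsum w z (fun t => G ((b + c)%N :: t))) +
     qsum x y (fun w => qsum w z (fun t => G ((a + b + c)%N :: t)))).
  rewrite (qsum_cons a x b y (fun w => qsum w (c :: z) G)).
  rewrite (qsum_cons a x b y (fun w => qsum w z _)).
  under eq_qsum do rewrite qsum_cons.
  under [X in _ + (X + _)]eq_qsum do rewrite qsum_cons.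
  under [X in _ + (_ + X)]eq_qsum do rewrite qsum_cons.
  by rewrite !qsumD; rewrite [LHS](AC ((1*(1*1))*((1*(1*1))*(1*(1*1))))
     (1*4*7*(2*(5*8))*(3*6*9))).
have Er : qsum (b :: y) (c :: z) (fun w => qsum (a :: x) w G) =
    qsum (b :: y) (c :: z) (fun w => qsum x w (fun t => G (a :: t))) +
    qsum y (c :: z) (fun w => qsum (a :: x) w (fun t => G (b :: t))) +
    qsum y (c :: z) (fun w => qsum x w (fun t => G ((a + b)%N :: t))) +
    qsum (b :: y) z (fun w => qsum (a :: x) w (fun t => G (c :: t))) +
    (qsum (b :: y) z (fun w => qsum x w (fun t => G ((a + c)%N :: t))) +
     qsum y z (fun w => qsum (a :: x) w (fun t => G ((b + c)%N :: t))) +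
     qsum y z (fun w => qsum x w (fun t => G ((a + b + c)%N :: t)))).
  rewrite (qsum_cons b y c z (fun w => qsum (a :: x) w G)).
  rewrite (qsum_cons b y c z (fun w => qsum x w _)).
  under eq_qsum do rewrite qsum_cons.
  under [X in _ + (X + _)]eq_qsum do rewrite qsum_cons.
  under [X in _ + (_ + X)]eq_qsum do (rewrite qsum_cons addnA).
  by rewrite !qsumD; rewrite [LHS](AC ((1*(1*1))*((1*(1*1))*(1*(1*1))))
     ((1*(4*7))*2*3*5*(6*8*9))).
by rewrite El Er !IHx !IHy IHz.
Qed.

End QuasiShuffleSum.

(** * Matrices as lists of columns *)

Definition mx_cols (M : mx2) : seq (nat * nat) :=
  [seq (tagged M 0 j, tagged M 1 j) | j : 'I_(tag M)].

Lemma mx_cols_inj : injective mx_cols.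
Proof.
move=> [l M] [l' M'] e; have el : l = l'.
  by have := congr1 size e; rewrite /mx_cols !size_map -!enumT !size_enum_ord.
case: _ / el in M' e *; congr (Tagged _ _); apply/matrixP => i j.
have /eq_in_map/(_ j) : mx_cols (Tagged (fun l => 'M_(2, l)) M) =
  mx_cols (Tagged (fun l => 'M_(2, l)) M') by [].
rewrite mem_enum => /(_ isT)[e0 e1].
have [->|->] // : i = 0 \/ i = 1.
by case: i => -[|[|]] // hi; [left|right]; apply: val_inj.
Qed.

Lemma mx_cols_row1 M : map fst (mx_cols M) = [seq tagged M 0 j | j : 'I_(tag M)].
Proof. by rewrite /mx_cols -map_comp. Qed.

Lemma mx_cols_row2 M : map snd (mx_cols M) = [seq tagged M 1 j | j : 'I_(tag M)].
Proof. by rewrite /mx_cols -map_comp. Qed.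

Lemma mx_cols_surj c : exists M, mx_cols M = c.
Proof.
pose M := \matrix_(i < 2, j < size c)
  (if i == 0 then (nth (0%N, 0%N) c j).1 else (nth (0%N, 0%N) c j).2).
exists (Tagged (fun l => 'M[nat]_(2, l)) M); rewrite /mx_cols /=.
rewrite -[RHS](mkseq_nth (0%N, 0%N)) /mkseq -val_enum_ord -map_comp.
by rewrite /image_mem; apply: eq_map => j; rewrite /= !mxE /= -surjective_pairing.
Qed.

(** [mx_cols] is a bijection from the set of matrices onto the duplicate-free list [cols], so the
    finite-support sum becomes a sum over that list. *)
Lemma harm_basisE k n : harm_basis k n = qsum (val k) (val n) basis_vec.
Proof.
have [k1 k0] := andP (valP k); have [n1 n0] := andP (valP n).
rewrite /qsum fsbig_seq ?cols_uniq //.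
rewrite (@reindex_fsbig _ _ _ _ _ mx_cols (harmonic_mx k n)); last first.
  split.
  - move=> M [M0 r0 r1 pos] /=; rewrite mem_cols //.
    rewrite mx_cols_row1 mx_cols_row2 /nonzeros -/(row_nz M 0) -/(row_nz M 1) r0 r1 !eqxx /=.
    by apply/mapP => -[j _ [e0 e1]]; have := pos j; rewrite -e0 -e1.
  - by move=> M M' _ _; apply: mx_cols_inj.
  move=> c /=; rewrite mem_cols // => /and3P[/eqP e0 /eqP e1 c0].
  have [M eM] := mx_cols_surj c; exists M => //; split.
  - rewrite lt0n; apply: contra_neq k1 => M0; rewrite -[LHS]e0 -eM mx_cols_row1.
    apply: size0nil; apply/eqP; rewrite -leqn0 size_filter.
    by rewrite (leq_trans (count_size _ _)) // size_map size_enum_ord M0.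
  - by rewrite -[RHS]e0 -eM mx_cols_row1.
  - by rewrite -[RHS]e1 -eM mx_cols_row2.
  move=> j; rewrite lt0n addn_eq0; apply: contra c0 => /andP[/eqP z0 /eqP z1].
  by rewrite -eM; apply/mapP; exists j; rewrite ?mem_enum // z0 z1.
by apply: eq_fsbigr => M _; rewrite /colsum /mx_cols -map_comp.
Qed.

Lemma harm_basisC k n : harm_basis k n = harm_basis n k.
Proof. by rewrite !harm_basisE qsumC. Qed.

(** * Linear spans *)

Section LinSpan.
Variables (F : fieldType) (E : lmodType F).
Implicit Types (S T : set E) (x y : E).

Lemma lin_span_sum S (I : Type) (r : seq I) (c : I -> F) (s : I -> E) :
  (forall i, S (s i)) -> lin_span S (\sum_(i <- r) c i *: s i).
Proof.
case: r => [|i0 r] hs.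
  by exists 0%N, (fun=> 0), (fun=> 0); split=> [[]//|]; rewrite big_nil big_ord0.
rewrite (big_nth i0) big_mkord.
exists (size (i0 :: r)), (fun i => c (nth i0 (i0 :: r) i)),
  (fun i => s (nth i0 (i0 :: r) i)).
by split.
Qed.

Lemma lin_span_incl S : S `<=` lin_span S.
Proof.
move=> x Sx; have := @lin_span_sum S nat [:: 0%N] (fun=> 1) (fun=> x) (fun=> Sx).
by rewrite big_seq1 scale1r.
Qed.

Lemma lin_span_ind S T : T 0 -> (forall a x y, T x -> T y -> T (a *: x + y)) ->
  S `<=` T -> lin_span S `<=` T.
Proof.
move=> T0 TD ST x [n [c [s [hs ->]]]].
elim/big_ind: _ => // [y z Ty Tz|i _]; first by rewrite -[y]scale1r; apply: TD.
by rewrite -[_ *: _]addr0; apply: TD => //; apply/ST/hs.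
Qed.

Lemma lin_span0 S : lin_span S 0.
Proof. by exists 0%N, (fun=> 0), (fun=> 0); split=> [[]//|]; rewrite big_ord0. Qed.

Lemma lin_span_lin S a x y : lin_span S x -> lin_span S y -> lin_span S (a *: x + y).
Proof.
move=> [n [c [s [hs ->]]]] [p [d [t [ht ->]]]].
pose cd (i : 'I_n + 'I_p) := match i with inl j => a * c j | inr j => d j end.
pose st (i : 'I_n + 'I_p) := match i with inl j => s j | inr j => t j end.
have hst i : S (st i) by case: i => j /=.
have := @lin_span_sum S _ (enum {: 'I_n + 'I_p}) cd st hst.
rewrite big_enum big_sumType /= scaler_sumr; congr (lin_span S (_ + _)).
by apply: eq_bigr => i _; rewrite scalerA.
Qed.

Lemma lin_spanD S x y : lin_span S x -> lin_span S y -> lin_span S (x + y).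
Proof. by move=> hx hy; rewrite -[x]scale1r; apply: lin_span_lin. Qed.

Lemma lin_spanZ S a x : lin_span S x -> lin_span S (a *: x).
Proof. by move=> hx; rewrite -[_ *: _]addr0; apply/lin_span_lin/lin_span0. Qed.

Lemma lin_span_bigsum S (I : eqType) (r : seq I) (P : pred I) (f : I -> E) :
  (forall i, i \in r -> P i -> lin_span S (f i)) -> lin_span S (\sum_(i <- r | P i) f i).
Proof.
move=> hf; rewrite big_seq_cond; elim/big_ind: _ => [|x y|i /andP[ir Pi]].
- exact: lin_span0.
- exact: lin_spanD.
- exact: hf.
Qed.

End LinSpan.

(** * Bilinearity, commutativity and associativity on V *)

HB.instance Definition _ (f : mindex -> V) :=
  GRing.isLinear.Build rat V V *:%R (lin_ext f) (lin_ext_is_linear f).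

Lemma malgU_scale (K : choiceType) (R : nzRingType) (k : K) (a : R) :
  << a *g k >> = a *: << 1 *g k >> :> {malg R[K]}.
Proof. by apply/malgP => l; rewrite mcoeffZ !mcoeffU mulr_natr. Qed.

Lemma V_ebasis (v : V) : v = \sum_(k <- msupp v) v@_k *: ebasis k.
Proof. by rewrite [LHS]monalgE; apply: eq_bigr => k _; apply: malgU_scale. Qed.

Lemma V_linear_ext (f g : V -> V) : linear f -> linear g ->
  (forall k, f (ebasis k) = g (ebasis k)) -> f =1 g.
Proof.
move=> lf lg fg v.
pose F : {linear V -> V} := HB.pack f (GRing.isLinear.Build rat V V *:%R f lf).
pose G : {linear V -> V} := HB.pack g (GRing.isLinear.Build rat V V *:%R g lg).
rewrite -[f]/(F : V -> V) -[g]/(G : V -> V) [v]V_ebasis !linear_sum.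
by apply: eq_bigr => k _; rewrite !linearZ /= fg.
Qed.

Lemma harmC : commutative harm.
Proof.
move=> v w; rewrite /harm exchange_big; apply: eq_bigr => n _.
by apply: eq_bigr => k _; rewrite mulrC harm_basisC.
Qed.

Lemma harm_linearl w a u v :
  harm (a *: u + v) w = a *: harm u w + harm v w.
Proof. by rewrite !harmE linearP. Qed.

Lemma harm_linearr v a u w :
  harm v (a *: u + w) = a *: harm v u + harm v w.
Proof. by rewrite (harmC v) harm_linearl !(harmC _ v). Qed.

HB.instance Definition _ (v : V) :=
  GRing.isLinear.Build rat V V *:%R (harm v) (harm_linearr v).

Lemma harm0l w : harm 0 w = 0.
Proof. by rewrite harmC linear0. Qed.

Lemma basis_vecE k : basis_vec (val k) = ebasis k.
Proof. by rewrite /basis_vec valK. Qed.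

Lemma mindex_word w : is_mindex w -> exists k : mindex, val k = w.
Proof. by move=> hw; exists (exist _ w hw). Qed.

Lemma harm_qsum x y : is_mindex x -> is_mindex y ->
  harm (basis_vec x) (basis_vec y) = qsum x y basis_vec.
Proof.
move=> /mindex_word[k <-] /mindex_word[n <-].
by rewrite !basis_vecE harmU harm_basisE.
Qed.

Lemma cols_mindex x y c : is_mindex x -> is_mindex y -> c \in cols x y ->
  is_mindex (colsum c) /\ sumn (colsum c) = (sumn x + sumn y)%N.
Proof.
move=> hx hy; have /andP[x1 x0] := hx; have /andP[y1 y0] := hy.
rewrite mem_cols // => /and3P[/eqP e0 /eqP e1 c0].
have es : sumn (colsum c) = (sumn x + sumn y)%N.
  by rewrite sumn_colsum -e0 -e1 !sumn_nonzeros.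
split=> //; rewrite /is_mindex colsum_neq0 // andbT.
apply: contraTneq (mindex_sumn hx) => c1; rewrite -eqn0Ngt.
by have /eqP := es; rewrite c1 /= eq_sym addn_eq0 => /andP[].
Qed.

Lemma harm_qsumr x y z : is_mindex x -> is_mindex y -> is_mindex z ->
  harm (basis_vec x) (qsum y z basis_vec) =
  qsum y z (fun w => qsum x w basis_vec).
Proof.
move=> hx hy hz; rewrite {1}/qsum linear_sum; apply: eq_big_seq => c.
by move=> /(cols_mindex hy hz)[hc _]; apply: harm_qsum.
Qed.

Lemma harmA_basis x y z : is_mindex x -> is_mindex y -> is_mindex z ->
  harm (basis_vec x) (harm (basis_vec y) (basis_vec z)) =
  harm (harm (basis_vec x) (basis_vec y)) (basis_vec z).
Proof.
move=> hx hy hz; rewrite [RHS]harmC.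
rewrite (harm_qsum hy hz) (harm_qsum hx hy) !harm_qsumr // -qsumA.
by apply: eq_qsum => w; apply: qsumC.
Qed.

(** Both bracketings are linear in each argument, which reduces the claim to basis vectors, where it
    is [qsumA] up to commutativity. *)
Lemma harmA : associative harm.
Proof.
have lin_l (v w : V) : linear (fun u => harm u (harm v w)) by exact: harm_linearl.
have lin_ll (v w : V) : linear (fun u => harm (harm u v) w).
  by move=> a x y; rewrite (harm_linearl v) (harm_linearl w).
have lin_r (u v : V) : linear (harm u \o harm v).
   move=> a x y; apply: etrans (congr1 (harm u) (harm_linearr v a x y)) _;
  exact: harm_linearr.
have lin_lr (u w : V) : linear (fun v => harm u (harm v w)).
  by move=> a x y; rewrite (harm_linearl w) (linearP (harm u)).
have lin_rl (u w : V) : linear (fun v => harm (harm u v) w).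
  move=> a x y; have e := congr1 (fun v => harm v w) (harm_linearr u a x y).
  by apply: etrans e _; apply: harm_linearl.
move=> u v w; apply: (V_linear_ext (lin_l v w) (lin_ll v w)) => k.
apply: (V_linear_ext (lin_lr (ebasis k) w) (lin_rl (ebasis k) w)) => l.
apply: (V_linear_ext (lin_r _ _) (linearP (harm (harm (ebasis k) (ebasis l))))) => n.
rewrite /comp -!basis_vecE; exact: harmA_basis (valP k) (valP l) (valP n).
Qed.

(** V has no unit, the empty word being excluded, so the product is formed in [option V] with [None]
    as neutral element; the empty list gets the default 0. *)
Definition harm_prod (L : seq (seq nat)) : V :=
  odflt 0 (\big[(oAC harmA harmC)/None]_(x <- L) Some (basis_vec x)).

Lemma harm_prodE x L :
  \big[(oAC harmA harmC)/None]_(y <- x :: L) Some (basis_vec y) =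
    Some (harm_prod (x :: L)).
Proof.
rewrite /harm_prod; elim: L x => [|z L IH] x; first by rewrite big_seq1.
by rewrite big_cons IH.
Qed.

Lemma harm_prod1 x : harm_prod [:: x] = basis_vec x.
Proof. by rewrite /harm_prod big_seq1. Qed.

Lemma harm_prod_perm L K : perm_eq L K -> harm_prod L = harm_prod K.
Proof. by move=> LK; rewrite /harm_prod (perm_big K). Qed.

Lemma harm_prod_cat L K : L != [::] -> K != [::] ->
  harm_prod (L ++ K) = harm (harm_prod L) (harm_prod K).
Proof.
case: L K => [|x L] [|y K] // _ _.
by rewrite {1}/harm_prod big_cat !harm_prodE.
Qed.

(** * Products of Lyndon words *)

(** The unique Lyndon factorization of [w]; the default [[::]] is returned only when there is
    none. *)
Definition fac (w : seq nat) : seq (seq nat) :=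
  xget [::] [set L | cfl L && (flatten L == w)].

Lemma facP w : 0%N \notin w -> cfl (fac w) /\ flatten (fac w) = w.
Proof.
move=> /cfl_exists[L hL eL].
have /andP[-> /eqP ->] // : [set L | cfl L && (flatten L == w)] (fac w).
by apply: xgetPex; exists L; rewrite /= hL eL eqxx.
Qed.

Lemma flatten_neq0 L : all lyndon L -> 0%N \notin flatten L.
Proof.
move=> hL; apply/negP => /flattenP[l lL]; apply/negP.
by have /andP[_ ->] := lyndon_mindex (allP hL _ lL).
Qed.

Lemma fac_flatten L : cfl L -> fac (flatten L) = L.
Proof.
move=> hL; have [|h e] := @facP (flatten L); last exact: cfl_inj.
by apply: flatten_neq0; case/andP: hL.
Qed.

Lemma fac_nil w : is_mindex w -> fac w != [::].
Proof.
by case/andP=> wn /facP[_ e]; apply: contraNneq wn => f0; rewrite -e f0.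
Qed.

Lemma fac_lyndon w : lyndon w -> fac w = [:: w].
Proof.
by move=> hw; rewrite -[X in fac X]cats0 -[w ++ _]/(flatten [:: w]) fac_flatten // /cfl /= hw.
Qed.

Lemma cfl_sort L : all lyndon L -> cfl (sort ge_slope L).
Proof. by move=> hL; rewrite /cfl all_sort hL sort_sorted //; apply: ge_slope_total. Qed.

Lemma sumn_flatten_perm (L K : seq (seq nat)) : perm_eq L K ->
  sumn (flatten L) = sumn (flatten K).
Proof. by move=> LK; rewrite !sumn_flatten; apply/perm_sumn/perm_map. Qed.

Definition lyndon_prod (w : seq nat) : V := harm_prod (fac w).

(** The witness has as factors those of [v] and [w] together, sorted by slope. There are at least
    two of them, so it is not Lyndon. *)
Lemma lyndon_prod_harm v w : is_mindex v -> is_mindex w -> exists x,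
  [/\ is_mindex x, sumn x = (sumn v + sumn w)%N, ~~ lyndon x
    & harm (lyndon_prod v) (lyndon_prod w) = lyndon_prod x].
Proof.
move=> hv hw; have /andP[_ v0] := hv; have /andP[_ w0] := hw.
have [/andP[av sv] ev] := facP v0; have [/andP[aw sw] ew] := facP w0.
have nv := fac_nil hv; have nw := fac_nil hw.
set L := fac v ++ fac w.
have aL : all lyndon L by rewrite all_cat av aw.
have pL : perm_eq (sort ge_slope L) L by rewrite perm_sort.
exists (flatten (sort ge_slope L)); split.
- apply: flatten_mindex; first by rewrite all_sort.
  by rewrite -size_eq0 size_sort size_cat addn_eq0 negb_and !size_eq0 nv.
- by rewrite (sumn_flatten_perm pL) flatten_cat sumn_cat ev ew.
- apply/negP => /fac_lyndon; rewrite fac_flatten ?cfl_sort // => /(congr1 size).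
  rewrite size_sort size_cat /=; case: (fac v) nv => // ? ? _.
  by case: (fac w) nw => // ? ? _; rewrite /= addnS.
by rewrite /lyndon_prod fac_flatten ?cfl_sort // (harm_prod_perm pL) harm_prod_cat.
Qed.

Definition lyndon_prods (n : nat) : set V :=
  [set lyndon_prod x | x in [set x | is_mindex x /\ sumn x = n]].

(** These are the products with at least two factors, since a word is Lyndon exactly when its
    factorization has one factor. *)
Definition decomposables (n : nat) : set V :=
  [set lyndon_prod x | x in [set x | [/\ is_mindex x, sumn x = n & ~~ lyndon x]]].

Lemma lin_span_sub (F : fieldType) (E : lmodType F) (S T : set E) :
  S `<=` T -> lin_span S `<=` lin_span T.
Proof.
move=> ST; apply: lin_span_ind => [|a x y|x /ST]; [exact: lin_span0| |exact: lin_span_incl].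
exact: lin_span_lin.
Qed.

Lemma harm_lyndon_prods m n v w :
  lin_span (lyndon_prods m) v -> lin_span (lyndon_prods n) w ->
  lin_span (decomposables (m + n)%N) (harm v w).
Proof.
move=> hv hw; pose T := [set v | lin_span (decomposables (m + n)%N) (harm v w)].
apply: (@lin_span_ind _ _ (lyndon_prods m) T) hv => [|a x y Tx Ty|_ [x [hx sx] <-]].
- by rewrite /T /= harm0l; apply: lin_span0.
- by rewrite /T /= (harm_linearl w a x y); exact: (lin_span_lin a Tx Ty).
pose T' := [set w | lin_span (decomposables (m + n)%N) (harm (lyndon_prod x) w)].
apply: (@lin_span_ind _ _ (lyndon_prods n) T') hw => [|a y z Ty Tz|_ [y [hy sy] <-]].
- by rewrite /T' /= (linear0 (harm (lyndon_prod x))); apply: lin_span0.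
- by rewrite /T' /= (harm_linearr (lyndon_prod x) a y z); exact: (lin_span_lin a Ty Tz).
have [z [hz sz lz e]] := lyndon_prod_harm hx hy.
by rewrite /T' /= e; apply: lin_span_incl; exists z => //; split; rewrite ?sz ?sx ?sy.
Qed.

(** The witness puts all columns of [p] before those of [s], merging none. *)
Lemma cat_mem_cols p s : 0%N \notin p -> 0%N \notin s ->
  exists2 c, c \in cols p s & colsum c = p ++ s.
Proof.
move=> p0 s0; exists ([seq (i, 0%N) | i <- p] ++ [seq (0%N, j) | j <- s]).
  rewrite mem_cols // !map_cat -!map_comp /nonzeros !filter_cat.
  have z (w : seq nat) : [seq x <- [seq 0%N | _ <- w] | x != 0%N] = [::] by elim: w.
  rewrite !z cats0 /= !map_id -!/(nonzeros _) !nonzeros_id // !eqxx /=.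
  rewrite mem_cat negb_or; apply/andP; split.
    by apply: contra p0 => /mapP[i ip [->]].
  by apply: contra s0 => /mapP[i ip [->]].
rewrite /colsum map_cat -!map_comp; congr (_ ++ _); last exact: map_id.
by rewrite -[RHS]map_id; apply: eq_map => i /=; rewrite addn0.
Qed.

(** Strong induction on the code. With [w = p ++ s] as in [min_slope_suffix], the codes of [p] and
    [s] are smaller than that of [w], and [w] is the leading term of their product. *)
Lemma lyndon_prod_span w : is_mindex w ->
  lin_span (lyndon_prods (sumn w)) (basis_vec w).
Proof.
have [n] := ubnP (bnum w); elim: n w => // n IH w; rewrite ltnS => hn hw.
have [p [s [ew hs hmin]]] := min_slope_suffix hw.
have ms := lyndon_mindex hs; have /andP[sn s0] := ms.
case: (eqVneq p [::]) => [p0|pn].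
  apply: lin_span_incl; exists w => //.
  by move: hs; rewrite ew p0 /= => /fac_lyndon; rewrite /lyndon_prod => ->; rewrite harm_prod1.
have mp : is_mindex p by move: hw; rewrite ew mindex_cat // => /andP[].
have /andP[_ p0] := mp.
have pos x : is_mindex x -> (0 < bnum x)%N.
  by move=> /bnum_ge; case: (bnum x) => //; rewrite leqn0 expn_eq0.
have hp : lin_span (lyndon_prods (sumn p)) (basis_vec p).
  apply: IH => //; apply: leq_trans _ hn; rewrite ew bnum_cat.
  have := pos _ ms; have : (0 < 2 ^ sumn s)%N by rewrite expn_gt0.
  by nia.
have hss : lin_span (lyndon_prods (sumn s)) (basis_vec s).
  apply: IH => //; apply: leq_trans _ hn; rewrite ew bnum_cat.
  have := pos _ mp; have : (0 < 2 ^ sumn s)%N by rewrite expn_gt0.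
  by nia.
have := harm_lyndon_prods hp hss.
have -> : (sumn p + sumn s)%N = sumn w by rewrite ew sumn_cat.
move=> /(@lin_span_sub _ _ _ (lyndon_prods (sumn w))) hps.
have {}hps : lin_span (lyndon_prods (sumn w)) (harm (basis_vec p) (basis_vec s)).
  by apply: hps => _ [x [hx sx _] <-]; exists x.
(* The terms equal to [w] are separated from the rest, whose codes are strictly smaller and which
   are covered by induction. *)
rewrite harm_qsum // /qsum (bigID (fun c => colsum c == w)) /= in hps.
set rest := (X in _ + X) in hps.
have hrest : lin_span (lyndon_prods (sumn w)) rest.
  apply: lin_span_bigsum => c hc cw.
  have [hz ez] := cols_mindex mp ms hc.
  have -> : sumn w = sumn (colsum c) by rewrite ez ew sumn_cat.
  apply: IH => //; apply: leq_trans _ hn.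
  rewrite ltn_neqAle; apply/andP; split.
    apply: contra cw => /eqP e; apply/eqP/bnum_inj => //; first by case/andP: hz.
    by case/andP: hw.
  rewrite ew; move: hc; rewrite mem_cols // => /and3P[/eqP e1 /eqP e2 _].
  apply: (@bnum_cols_le (slope s)) e1 e2 => u v e.
    (* For a suffix [v] of [p], [v ++ s] is a suffix of [w]; minimality of [s] and the mediant
       property bound the slope of [v] below by that of [s]. *)
    case: (eqVneq v [::]) => [->|vn]; first by rewrite excess_nil.
    have mv : is_mindex v by move: p0; rewrite /is_mindex vn e mem_cat negb_or => /andP[].
    rewrite -slope_ge // -slope_suffix_le_cat //.
    apply: (hmin u); first by rewrite ew e catA.
    by rewrite -size_eq0 size_cat addn_eq0 negb_and !size_eq0 vn.
  (* Proper prefixes of the Lyndon word [s] have smaller slope, and [s] itself has excess 0. *)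
  case: (eqVneq u [::]) => [->|un]; first by rewrite excess_nil.
  case: (eqVneq v [::]) => [vv|vn]; first by rewrite -[u]cats0 -vv -e excess_slope.
  have /andP[mu mv] : is_mindex u && is_mindex v by rewrite -mindex_cat // -e.
  rewrite -slope_le // e ltW // slope_prefix_lt_cat //.
  by move: hs => /lyndonP[_ /(_ _ _ e un vn)].
have {}hps := lin_spanD hps (lin_spanZ (-1) hrest).
rewrite scaleN1r addrK in hps.
have [c0 hc0 ec0] := cat_mem_cols p0 s0.
rewrite (eq_bigr (fun=> basis_vec w)) in hps; last by move=> c /eqP ->.
rewrite big_const_seq iter_addr_0 -scaler_nat in hps.
set k := count _ _ in hps.
(* The multiplicity [k] of [w] is positive because the unmerged matrix occurs, hence invertible in
   the rationals. *)
have k0 : k%:R != 0 :> rat.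
  by rewrite pnatr_eq0 -lt0n -has_count; apply/hasP; exists c0 => //; rewrite ec0 ew.
by have := lin_spanZ (k%:R)^-1 hps; rewrite scalerA mulVf // scale1r.
Qed.

(** * Counting Lyndon words *)

Definition incr_head (w : seq nat) : seq nat :=
  if w is a :: w' then a.+1 :: w' else [::].

(** The compositions of [m]. The filter drops the empty composition, which has no first part to
    increase; beyond [m] = 1 it removes nothing, so each step doubles the list. *)
Fixpoint comps (m : nat) : seq (seq nat) :=
  if m is k.+1 then
    [seq 1%N :: w | w <- comps k] ++
    [seq incr_head w | w <- [seq w <- comps k | w != [::]]]
  else [:: [::]].

Lemma mem_comps m w : (w \in comps m) = (0%N \notin w) && (sumn w == m).
Proof.
elim: m w => [|m IH] w.
  rewrite inE; case: w => [|a w] //; apply/esym/negP => /andP[w0 /eqP s0].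
  by have := @mindex_sumn (a :: w) w0; rewrite s0.
rewrite /= mem_cat; case: w => [|[|[|a]] w] //.
- by rewrite nil_map_cons /=; apply/negbTE/mapP => -[[|b w]] //; rewrite mem_filter.
- by rewrite mem_map_cons /=; apply/negbTE/mapP => -[[|b v]] //; rewrite mem_filter.
- rewrite mem_map_cons eqxx IH inE /= eqSS.
  apply: orb_idr => /mapP[[|b w']]; rewrite mem_filter // IH => /andP[_].
  by rewrite inE => /andP[+ _] [b0]; rewrite -b0.
rewrite mem_map_cons /= !inE /= addSn eqSS.
apply/mapP/andP => [[[|b w']]|[w0 es]].
  - by rewrite mem_filter.
  - rewrite mem_filter IH inE negb_or => /andP[_ /andP[/andP[_ w0] es]] [-> ->].
    by rewrite w0 es.
by exists (a.+1 :: w) => //; rewrite mem_filter IH inE w0.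
Qed.

Lemma comps_uniq m : uniq (comps m).
Proof.
elim: m => //= m IH; have cI : injective (cons 1%N) by move=> ? ? [].
rewrite cat_uniq (map_inj_uniq cI) IH /=.
have h : {in [seq w <- comps m | w != [::]] &, injective incr_head}.
  move=> x y; rewrite !mem_filter => /andP[xn _] /andP[yn _].
  by case: x y xn yn => [|a w] [|b v] //= _ _ [-> ->].
rewrite (map_inj_in_uniq h) filter_uniq // andbT; apply/hasPn => x.
case/mapP=> -[|a w]; rewrite mem_filter // mem_comps => /and3P[_ w0 _] ->.
by apply/negP => /mapP[v _ [a0 _]]; rewrite a0 inE in w0.
Qed.

Lemma size_comps m : size (comps m.+1) = (2 ^ m)%N.
Proof.
elim: m => [|m IH] //.
have -> : comps m.+2 = [seq 1%N :: w | w <- comps m.+1] ++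
  [seq incr_head w | w <- [seq w <- comps m.+1 | w != [::]]] by [].
rewrite size_cat !size_map expnS mul2n -addnn -IH; congr (_ + _)%N.
have /all_filterP -> // : all (fun w => w != [::]) (comps m.+1).
by apply/allP => w; rewrite mem_comps => /andP[_]; apply: contraTneq => ->.
Qed.

(** * Multiplicities of Lyndon factors *)

Lemma cfl_perm_eq L K : cfl L -> cfl K -> perm_eq L K -> L = K.
Proof.
case/andP=> aL sL /andP[aK sK] LK; apply: (sorted_eq_in _ _ sL sK LK).
  by move=> x y z _ _ _; apply: ge_slope_trans.
(* [ge_slope] is antisymmetric on Lyndon words, since their slopes determine them. *)
move=> x y xL yL /le_anti e.
by apply: lyndon_slope_inj => //; apply: (allP aL).
Qed.

Lemma sumn_mem_flatten (L : seq (seq nat)) l : l \in L -> (sumn l <= sumn (flatten L))%N.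
Proof.
by move=> /perm_to_rem /sumn_flatten_perm ->; rewrite /= sumn_cat leq_addr.
Qed.

Definition insert_lyndon l v := flatten (sort ge_slope (l :: fac v)).

Lemma fac_insert l v : lyndon l -> 0%N \notin v ->
  fac (insert_lyndon l v) = sort ge_slope (l :: fac v).
Proof.
move=> hl /facP[/andP[av _] _]; rewrite /insert_lyndon fac_flatten // cfl_sort //.
by rewrite /= hl.
Qed.

Lemma sumn_insert l v : 0%N \notin v -> sumn (insert_lyndon l v) = (sumn l + sumn v)%N.
Proof.
move=> /facP[_ ev]; rewrite /insert_lyndon (@sumn_flatten_perm _ (l :: fac v)) ?perm_sort //.
by rewrite /= sumn_cat ev.
Qed.

(** Inserting [l] among the factors is a bijection onto the words having [l] as a factor; its
    inverse removes one copy of [l]. *)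
Lemma insert_lyndon_perm m l : lyndon l -> (sumn l <= m)%N ->
  perm_eq [seq w <- comps m | l \in fac w]
          [seq insert_lyndon l v | v <- comps (m - sumn l)].
Proof.
move=> hl lm; apply: uniq_perm; first exact/filter_uniq/comps_uniq.
  rewrite map_inj_in_uniq ?comps_uniq // => v w.
  rewrite !mem_comps => /andP[v0 _] /andP[w0 _] /(congr1 fac).
  rewrite !fac_insert // => e.
  have : perm_eq (l :: fac v) (l :: fac w).
    by rewrite -(perm_sort ge_slope) e perm_sort.
  rewrite perm_cons; have [cv ev] := facP v0; have [cw ew] := facP w0.
  by move=> /(cfl_perm_eq cv cw) evw; rewrite -ev -ew evw.
move=> w; rewrite mem_filter mem_comps.
apply/and3P/mapP => [[lw w0 /eqP sw]|[v]]; last first.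
  rewrite mem_comps => /andP[v0 /eqP sv] ->.
  rewrite fac_insert // mem_sort mem_head sumn_insert // sv subnKC //; split=> //.
  apply: flatten_neq0; rewrite all_sort /= hl.
  by have [/andP[]] := facP v0.
have [/andP[aw sw'] ew] := facP w0.
have cr : cfl (rem l (fac w)).
  rewrite /cfl (subseq_sorted ge_slope_trans (rem_subseq _ _)) // andbT.
  by apply/allP => x /mem_rem; apply/(allP aw).
have pr := perm_to_rem lw.
have v0 : 0%N \notin flatten (rem l (fac w)).
  by apply: flatten_neq0; case/andP: cr.
exists (flatten (rem l (fac w))).
  rewrite mem_comps v0 /= -sw -{2}ew (sumn_flatten_perm pr) /= sumn_cat.
  by rewrite addKn.
rewrite /insert_lyndon fac_flatten // -[LHS]ew; congr flatten.
apply: cfl_perm_eq.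
- by rewrite /cfl aw.
- by rewrite cfl_sort //= hl; case/andP: cr.
by rewrite (perm_trans pr) // perm_sym perm_sort.
Qed.

Definition mult_total m l := (\sum_(w <- comps m) count_mem l (fac w))%N.

(** Removing one copy of [l] reaches every word of weight [m - sumn l] exactly once and lowers the
    multiplicity by one. *)
Lemma mult_total_rec m l : lyndon l -> mult_total m l =
  if (sumn l <= m)%N then (size (comps (m - sumn l)) + mult_total (m - sumn l) l)%N
  else 0%N.
Proof.
move=> hl; rewrite /mult_total (bigID (fun w => l \in fac w)) /=.
rewrite [X in (_ + X)%N]big1 ?addn0; last by move=> w /count_memPn.
case: ifPn => lm; last first.
  rewrite big_seq_cond big1 // => w /andP[+ lw]; rewrite mem_comps => /andP[w0 /eqP sw].
  case/negP: lm; rewrite -sw; have [_ <-] := facP w0.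
  exact: sumn_mem_flatten.
rewrite -big_filter (perm_big _ (insert_lyndon_perm hl lm)) big_map.
rewrite -sum1_size -big_split /=; apply: eq_big_seq => v.
rewrite mem_comps => /andP[v0 _].
by rewrite fac_insert // count_sort /= eqxx.
Qed.

Lemma mult_totalE m l : lyndon l ->
  mult_total m l = (\sum_(1 <= k < m.+1 | sumn l %| k) size (comps (m - k)))%N.
Proof.
move=> hl; have l0 := mindex_sumn (lyndon_mindex hl).
have [n] := ubnP m; elim: n m => // n IH m mn; rewrite mult_total_rec //.
case: ifPn => lm; last first.
  rewrite big_nat_cond big1 // => k /andP[/andP[k0 km] /dvdn_leq]; lia.
rewrite IH; last by lia.
rewrite [RHS](big_cat_nat (n := sumn l)) //=; last by lia.
rewrite [X in _ = (X + _)%N]big_nat_cond [X in _ = (X + _)%N]big1 ?add0n; last first.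
  by move=> k /andP[/andP[k0 km] /dvdn_leq]; lia.
have -> : (\sum_(sumn l <= k < m.+1 | sumn l %| k) size (comps (m - k)) =
  \sum_(0 <= k < (m - sumn l).+1 | sumn l %| k + sumn l)
    size (comps (m - (k + sumn l))))%N.
  by rewrite -{1}[sumn l]add0n big_addn subSn.
(* After the shift, index 0 stands for the multiple [sumn l] itself; the other indices give the
   induction hypothesis. *)
rewrite [RHS]big_mkcond big_nat_recl //=.
rewrite add0n dvdnn; congr (_ + _)%N.
rewrite [LHS]big_mkcond /= (big_addn 0 _ 1) subn1 /=; apply: eq_bigr => k _; rewrite addn1.
by rewrite dvdn_addl // subnDA subnAC.
Qed.

Definition lyndons d := [seq w <- comps d | lyndon w].

Lemma sumn_fac_sum w m : 0%N \notin w -> (sumn w <= m)%N ->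
  sumn w = (\sum_(1 <= d < m.+1) \sum_(l <- lyndons d) count_mem l (fac w) * d)%N.
Proof.
move=> w0 wm; have [/andP[aw _] ew] := facP w0.
rewrite -{1}ew sumn_flatten sumnE big_map.
transitivity (\sum_(x <- fac w) \sum_(1 <= d < m.+1) \sum_(l <- lyndons d) (x == l) * d)%N.
  apply: eq_big_seq => x xw; have hx := allP aw _ xw.
  have sx := sumn_mem_flatten xw; rewrite ew in sx.
  have x0 := mindex_sumn (lyndon_mindex hx).
  rewrite (bigD1_seq (sumn x)) ?iota_uniq ?mem_index_iota ?x0 /=; last 2 first.
  - by rewrite ltnS (leq_trans sx).
  - by [].
  rewrite [X in (_ + X)%N]big1 ?addn0; last first.
    move=> d dx; rewrite big_seq big1 // => l; rewrite mem_filter mem_comps.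
    move=> /and3P[_ _ /eqP sl]; case: eqP => // xl; move: dx.
    by rewrite -sl xl eqxx.
  rewrite -big_distrl /= -[LHS]mul1n; congr (_ * _)%N.
  have xin : x \in lyndons (sumn x).
    by rewrite mem_filter hx mem_comps eqxx andbT; case/andP: (lyndon_mindex hx).
  rewrite (bigD1_seq x) ?filter_uniq ?comps_uniq //= eqxx big1 // => l.
  by rewrite eq_sym => /negPf ->.
rewrite exchange_big; apply: eq_bigr => d _ /=; rewrite exchange_big.
apply: eq_bigr => l _ /=; rewrite -big_distrl /=; congr (_ * _)%N.
rewrite -sum1_count; rewrite [RHS]big_mkcond; apply: eq_bigr => x _ /=.
by case: (x == l).
Qed.

(** Double counting of the total weight of all words of weight [m]: word by word, and Lyndon factor
    by Lyndon factor through [mult_totalE]. *)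
Lemma comps_convolution m :
  (\sum_(1 <= k < m.+1)
     (\sum_(d <- divisors k) d * size (lyndons d)) * size (comps (m - k)) =
   m * size (comps m))%N.
Proof.
transitivity (\sum_(w <- comps m) sumn w)%N; last first.
  rewrite -sum1_size big_distrr /=; apply: eq_big_seq => w.
  by rewrite mem_comps muln1 => /andP[_ /eqP].
transitivity (\sum_(1 <= d < m.+1) \sum_(l <- lyndons d) mult_total m l * d)%N; last first.
  transitivity (\sum_(w <- comps m) \sum_(1 <= d < m.+1)
      \sum_(l <- lyndons d) count_mem l (fac w) * d)%N; last first.
    apply: eq_big_seq => w; rewrite mem_comps => /andP[w0 /eqP sw].
    by rewrite -sumn_fac_sum // sw.
  rewrite exchange_big; apply: eq_bigr => d _; rewrite exchange_big.
  by apply: eq_bigr => l _; rewrite -big_distrl.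
transitivity (\sum_(1 <= d < m.+1) \sum_(1 <= k < m.+1 | d %| k)
   d * size (lyndons d) * size (comps (m - k)))%N; last first.
  apply: eq_big_nat => d d1; under eq_big_seq => l.
    rewrite mem_filter mem_comps => /and3P[hl _ /eqP sl].
    rewrite mult_totalE // sl; over.
  rewrite big_const_seq iter_addn_0 -big_distrr /= -/(size _).
  rewrite count_predT; ring.
rewrite (exchange_big_dep_nat xpredT) //=; apply: eq_big_nat => k /andP[k1 km].
rewrite big_distrl /= -[RHS]big_filter; apply: perm_big; apply: uniq_perm.
- exact: divisors_uniq.
- exact/filter_uniq/iota_uniq.
move=> d; rewrite mem_filter mem_index_iota -dvdn_divisors //.
apply/idP/andP => [dk|[] //]; split=> //.
by rewrite (dvdn_gt0 _ dk) //= (leq_ltn_trans (dvdn_leq _ dk)).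
Qed.

Lemma convolution_comps_inj (a b : nat -> nat) :
  (forall m, \sum_(1 <= k < m.+1) a k * size (comps (m - k)) =
             \sum_(1 <= k < m.+1) b k * size (comps (m - k)))%N ->
  forall m, (0 < m)%N -> a m = b m.
Proof.
move=> h m; have [n] := ubnP m; elim: n m => // n IH [//|m] mn _.
(* The system is unitriangular: the last term has coefficient [size (comps 0)], which is 1. *)
have := h m.+1; rewrite !(@big_nat_recr _ _ _ m.+1) // !subnn !muln1.
rewrite (eq_big_nat _ _ (F2 := fun k => b k * size (comps (m.+1 - k)))%N).
  by move/addnI.
by move=> k /andP[k1 km]; rewrite IH //; lia.
Qed.

(** The powers of 2 minus one satisfy the system of [comps_convolution], whose solution is
    unique. *)
Lemma pow2_convolution m :
  (\sum_(1 <= k < m.+1) (2 ^ k - 1) * size (comps (m - k)) = m * size (comps m))%N.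
Proof.
case: m => [|m]; first by rewrite big_geq.
elim: m => [|m IH]; first by rewrite big_nat1.
rewrite (@big_nat_recr _ _ _ m.+2) // (@big_nat_recr _ _ _ m.+1) // subnn subSnn.
(* The number of compositions doubles from each positive weight to the next, so all terms double
   except the last two, which are split off because weight 0 breaks the pattern. *)
have -> : (\sum_(1 <= k < m.+1) (2 ^ k - 1) * size (comps (m.+2 - k)) =
  2 * \sum_(1 <= k < m.+1) (2 ^ k - 1) * size (comps (m.+1 - k)))%N.
  rewrite big_distrr /=; apply: eq_big_nat => k /andP[k1 km].
  have -> : (m.+2 - k = (m - k).+2)%N by lia.
  have -> : (m.+1 - k = (m - k).+1)%N by lia.
  by rewrite !size_comps expnS mulnCA.
move: IH; rewrite (@big_nat_recr _ _ _ m.+1) // subnn !size_comps !expnS.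
have : (0 < 2 ^ m)%N by rewrite expn_gt0.
by move: (\sum_(_ <= _ < _) _)%N (2 ^ m)%N => S t t0 /=; nia.
Qed.

Lemma sum_divisors_lyndons m : (0 < m)%N ->
  (\sum_(d <- divisors m) d * size (lyndons d) = 2 ^ m - 1)%N.
Proof.
move=> m0; apply: (@convolution_comps_inj
  (fun m => \sum_(d <- divisors m) d * size (lyndons d))%N
  (fun m => 2 ^ m - 1)%N _ _ m0) => k.
by rewrite comps_convolution pow2_convolution.
Qed.

(** * Moebius inversion *)

Lemma moebius_prime_mul p d : prime p -> (0 < d)%N -> ~~ (p %| d)%N ->
  moebius (p * d) = - moebius d.
Proof.
move=> pp d0 pd; have p0 := prime_gt0 pp.
have pm : perm_eq (primes (p * d)) (p :: primes d).
  apply: uniq_perm; rewrite ?primes_uniq //=.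
    by rewrite primes_uniq mem_primes (negPf pd) !andbF.
  by move=> q; rewrite primesM // primes_prime // !inE.
have lpd : logn p d = 0%N.
  by apply/eqP; rewrite -leqn0 leqNgt logn_gt0 mem_primes (negPf pd) !andbF.
rewrite /moebius (perm_all _ pm) (perm_size pm) /= lognM // lpd.
rewrite logn_prime // eqxx /=.
have -> : all (fun q => logn q (p * d) == 1%N) (primes d) =
          all (fun q => logn q d == 1%N) (primes d).
  apply: eq_in_all => q; rewrite mem_primes => /and3P[qp _ qd].
  have /negPf qp' : q != p by apply: contraNneq pd => <-.
  by rewrite lognM // logn_prime // qp'.
by case: ifP; rewrite ?oppr0 // exprS mulN1r.
Qed.

Lemma moebius_nonsquarefree p d : prime p -> (0 < d)%N -> (1 < logn p d)%N ->
  moebius d = 0.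
Proof.
move=> pp d0 h; have pd : p \in primes d by rewrite -logn_gt0 ltnW.
by rewrite /moebius; case: ifP => // /allP/(_ p pd)/eqP e; rewrite e in h.
Qed.

(** For a prime [p] dividing [n], divisors divisible by the square of [p] contribute 0, and those
    divisible by [p] exactly once cancel against those prime to [p]. *)
Lemma sum_moebius n : (0 < n)%N ->
  \sum_(d <- divisors n) moebius d = (n == 1%N)%:R.
Proof.
move=> n0; case: eqVneq => [->|n1]; first by rewrite big_seq1.
have n_gt1 : (1 < n)%N by lia.
have pp := pdiv_prime n_gt1; have pn := pdiv_dvd n; set p := pdiv n in pp pn.
have p0 := prime_gt0 pp.
rewrite (bigID (fun d => p %| d)%N) /= (bigID (fun d => logn p d == 1%N)) /=.
rewrite [X in _ + X + _]big_seq_cond [X in _ + X + _]big1 ?addr0; last first.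
  move=> d /and3P[]; rewrite -dvdn_divisors // => dn /= pd ld.
  have d0 := dvdn_gt0 n0 dn.
  apply: (moebius_nonsquarefree pp d0).
  have : (0 < logn p d)%N by rewrite logn_gt0 mem_primes pp d0.
  by move: ld; case: (logn p d) => [|[]].
rewrite -big_filter -[X in _ + X]big_filter.
have pm : perm_eq
    [seq d <- divisors n | (p %| d)%N && (logn p d == 1%N)]
    [seq (p * d)%N | d <- [seq d <- divisors n | ~~ (p %| d)%N]].
  apply: uniq_perm; rewrite ?filter_uniq ?divisors_uniq //.
    rewrite map_inj_uniq ?filter_uniq ?divisors_uniq // => x y /eqP.
    by rewrite eqn_pmul2l // => /eqP.
  move=> d; rewrite mem_filter -dvdn_divisors //.
  apply/andP/mapP => [[/andP[pd /eqP ld] dn]|[e]].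
    have d0 := dvdn_gt0 n0 dn.
    case/dvdnP: pd => e de; exists e; last by rewrite mulnC.
    have e0 : (0 < e)%N by move: d0; rewrite de muln_gt0 => /andP[].
    rewrite mem_filter -dvdn_divisors // (dvdn_trans _ dn) ?de ?dvdn_mulr // andbT.
    move: ld; rewrite de lognM // (logn_prime _ pp) eqxx addn1 => -[le].
    by apply/negP => pe; have := logn_gt0 p e; rewrite mem_primes pp e0 pe le.
  rewrite mem_filter -dvdn_divisors // => /andP[pe en] ->.
  have e0 := dvdn_gt0 n0 en.
  rewrite dvdn_mulr //= lognM // (logn_prime _ pp) eqxx.
  have -> : logn p e = 0%N.
    by apply/eqP; rewrite -leqn0 leqNgt logn_gt0 mem_primes (negPf pe) !andbF.
  by split=> //; rewrite Gauss_dvd ?pn // prime_coprime.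
rewrite (perm_big _ pm) big_map -big_split big_seq big1 // => d.
rewrite mem_filter -dvdn_divisors // => /andP[pd dn].
by rewrite (moebius_prime_mul pp (dvdn_gt0 n0 dn) pd) /= addNr.
Qed.

Lemma divisors_quotients n : (0 < n)%N ->
  perm_eq (divisors n) [seq (n %/ d)%N | d <- divisors n].
Proof.
move=> n0.
have dd d : (d %| n)%N -> (n %/ (n %/ d))%N = d.
  move=> dn; have d0 := dvdn_gt0 n0 dn.
  by rewrite -{1}(divnK dn) mulKn // divn_gt0 // dvdn_leq.
apply: uniq_perm; rewrite ?divisors_uniq //.
  rewrite map_inj_in_uniq ?divisors_uniq // => x y.
  by rewrite -!dvdn_divisors // => xn yn e; rewrite -(dd x) // e dd.
move=> d; rewrite -dvdn_divisors //; apply/idP/mapP => [dn|[e]].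
  exists (n %/ d)%N; rewrite ?dd // -dvdn_divisors //.
  by rewrite dvdn_divLR ?dvdn_mulr // (dvdn_gt0 n0).
by rewrite -dvdn_divisors // => en ->; apply: dvdn_div.
Qed.

Lemma moebius_inversion (c b : nat -> int) :
  (forall n, (0 < n)%N -> b n = \sum_(d <- divisors n) c d) ->
  forall n, (0 < n)%N -> \sum_(d <- divisors n) moebius (n %/ d) * b d = c n.
Proof.
move=> bc n n0.
transitivity (\sum_(d <- divisors n) \sum_(e <- divisors n | (e %| d)%N)
    moebius (n %/ d) * c e).
  apply: eq_big_seq => d; rewrite -dvdn_divisors // => dn.
  have d0 := dvdn_gt0 n0 dn.
  rewrite bc // big_distrr /= -[RHS]big_filter; apply: perm_big; apply: uniq_perm.
  - exact: divisors_uniq.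
  - exact/filter_uniq/divisors_uniq.
  move=> e; rewrite mem_filter -!dvdn_divisors //.
  by apply/idP/andP => [ed|[]//]; split=> //; apply: dvdn_trans dn.
rewrite (exchange_big_dep xpredT) //=.
transitivity (\sum_(e <- divisors n) (e == n)%:R * c e).
  apply: eq_big_seq => e; rewrite -dvdn_divisors // => en.
  have e0 := dvdn_gt0 n0 en.
  have ne0 : (0 < n %/ e)%N by rewrite divn_gt0 // dvdn_leq.
  rewrite -big_distrl /=; congr (_ * _).
  have -> : (e == n) = (n %/ e == 1)%N.
    by rewrite -[RHS](eqn_pmul2r e0) divnK // mul1n eq_sym.
  rewrite -sum_moebius // (perm_big _ (divisors_quotients ne0)) big_map.
  (* Writing d = e t turns the inner sum into the full Moebius sum for n / e, which survives only at
     e = n. *)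
  have pm : perm_eq [seq d <- divisors n | (e %| d)%N]
                    [seq (e * t)%N | t <- divisors (n %/ e)].
    apply: uniq_perm; first exact/filter_uniq/divisors_uniq.
      rewrite map_inj_uniq ?divisors_uniq // => x y /eqP.
      by rewrite eqn_pmul2l // => /eqP.
    move=> d; rewrite mem_filter -dvdn_divisors //.
    apply/andP/mapP => [[/dvdnP[t ->] tn]|[t]].
      by exists t; rewrite 1?mulnC // -dvdn_divisors // dvdn_divRL.
    by rewrite -dvdn_divisors // dvdn_divRL // => tn ->; rewrite dvdn_mulr // mulnC.
  rewrite -big_filter (perm_big _ pm) big_map.
  by apply: eq_bigr => t _; rewrite divnMA.
rewrite (bigD1_seq n) ?divisors_uniq -?dvdn_divisors //= eqxx mul1r big1 ?addr0 //.
by move=> e /negPf ->; rewrite mul0r.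
Qed.

Lemma lyndons_moebius m : (1 < m)%N ->
  m%:Z * (size (lyndons m))%:Z =
  \sum_(d <- divisors m) moebius (m %/ d) * 2 ^+ d.
Proof.
move=> m1; have m0 : (0 < m)%N by lia.
have h n : (0 < n)%N -> (2 ^+ n - 1 : int) =
    \sum_(d <- divisors n) d%:Z * (size (lyndons d))%:Z.
  move=> n0; transitivity ((2 ^ n - 1)%N%:R : int).
    by rewrite natrB ?expn_gt0 // natrX.
  rewrite -(sum_divisors_lyndons n0) natr_sum; apply: eq_bigr => d _.
  by rewrite natz PoszM.
rewrite -(moebius_inversion h m0).
(* The constant -1 in 2 ^ d - 1 contributes a full Moebius sum, which vanishes because [m] is not
   1. *)
under eq_bigr do rewrite mulrBr mulr1.
rewrite sumrB -[X in _ - X](big_map (fun d => m %/ d)%N xpredT moebius).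
rewrite -(perm_big _ (divisors_quotients m0)) sum_moebius //.
by have /negPf -> : m != 1%N; [lia|rewrite subr0].
Qed.

(** * Dimensions *)

Lemma mcoeff_ebasis k l : (ebasis k)@_l = (k == l)%:R.
Proof. by rewrite /ebasis mcoeffU. Qed.

Lemma mcoeff_sum (I : Type) (r : seq I) (f : I -> V) k :
  (\sum_(i <- r) f i)@_k = \sum_(i <- r) (f i)@_k.
Proof. exact: raddf_sum. Qed.

Lemma V_weightP n v : V_ n v <-> forall k, weight k <> n -> v@_k = 0.
Proof.
split=> [|h].
  pose T := [set v : V | forall k, weight k <> n -> v@_k = 0].
  apply: (@lin_span_ind _ _ _ T) => [k _|a x y hx hy k wk|_ [l wl <-] k wk].
  - by rewrite mcoeff0.
  - by rewrite mcoeffD mcoeffZ hx // hy // mulr0 addr0.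
  by rewrite mcoeff_ebasis; case: eqP wk => // <-.
rewrite [v]V_ebasis; apply: lin_span_bigsum => k; rewrite -mcoeff_neq0 => vk _.
apply/lin_spanZ/lin_span_incl; exists k => //=.
by apply/eqP; apply: contraNT vk => /eqP wk; rewrite h.
Qed.

Lemma V_bigsum n (I : eqType) (r : seq I) (f : I -> V) :
  (forall i, i \in r -> V_ n (f i)) -> V_ n (\sum_(i <- r) f i).
Proof. by move=> h; apply: lin_span_bigsum => i ir _; apply: h. Qed.

Lemma basis_vec_V w : is_mindex w -> V_ (sumn w) (basis_vec w).
Proof.
move=> /mindex_word[k <-]; rewrite basis_vecE; apply: lin_span_incl.
by exists k.
Qed.

Lemma harm_basis_V k l : V_ (weight k + weight l)%N (harm_basis k l).
Proof.
rewrite harm_basisE; apply: V_bigsum => c /(cols_mindex (valP k) (valP l))[hc <-].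
exact: basis_vec_V.
Qed.

Lemma harm_V m n v w : V_ m v -> V_ n w -> V_ (m + n)%N (harm v w).
Proof.
move=> /V_weightP hv /V_weightP hw; apply: V_bigsum => k; rewrite -mcoeff_neq0 => vk.
apply: V_bigsum => l; rewrite -mcoeff_neq0 => wl; apply: lin_spanZ.
have <- : weight k = m by apply/eqP; apply: contraNT vk => /eqP wk; rewrite hv.
have <- : weight l = n by apply/eqP; apply: contraNT wl => /eqP wk; rewrite hw.
exact: harm_basis_V.
Qed.

Lemma harm_prod_V L : all lyndon L -> L != [::] ->
  V_ (sumn (flatten L)) (harm_prod L).
Proof.
elim: L => // x [|y L] IH /andP[hx hL] _.
  by rewrite harm_prod1 /= cats0; apply/basis_vec_V/lyndon_mindex.
rewrite (@harm_prod_cat [:: x]) // harm_prod1 -cat1s flatten_cat sumn_cat.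
apply: harm_V; last exact: IH.
by rewrite /= cats0; apply/basis_vec_V/lyndon_mindex.
Qed.

Lemma lyndon_prod_V w : is_mindex w -> V_ (sumn w) (lyndon_prod w).
Proof.
move=> hw; have /andP[_ /facP[/andP[aw _] ew]] := hw.
by rewrite -{1}ew; apply: harm_prod_V => //; apply: fac_nil.
Qed.

Section Free.
Variables (F : fieldType) (E : lmodType F) (N : nat).

Lemma lin_span_rangeP (b : 'I_N -> E) x :
  lin_span (range b) x -> exists c, x = \sum_i c i *: b i.
Proof.
pose T := [set x | exists c, x = \sum_i c i *: b i].
apply: (@lin_span_ind _ _ _ T) => [|a _ _ [c ->] [d ->]|_ [j _ <-]].
- by exists (fun=> 0); rewrite big1 // => i _; rewrite scale0r.
- exists (fun i => a * c i + d i); rewrite scaler_sumr -big_split.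
  by apply: eq_bigr => i _; rewrite scalerDl scalerA.
exists (fun i => (i == j)%:R); rewrite (bigD1 j) //= eqxx scale1r big1 ?addr0 //.
by move=> i /negPf ->; rewrite scale0r.
Qed.

(** Freeness of [b] gives [MA *m MC = 1]. The matrices are square, so [MC *m MA = 1] too, and a
    relation among the [p] killed by [MC] is zero. *)
Lemma free_same_span (b p : 'I_N -> E) :
  (forall c, \sum_i c i *: b i = 0 -> forall i, c i = 0) ->
  (forall i, lin_span (range b) (p i)) -> (forall i, lin_span (range p) (b i)) ->
  forall c, \sum_i c i *: p i = 0 -> forall i, c i = 0.
Proof.
move=> bfree pb bp c c0.
have [C hC] := choice (fun i => lin_span_rangeP (pb i)).
have [A hA] := choice (fun i => lin_span_rangeP (bp i)).
pose MA := \matrix_(i, j) A i j; pose MC := \matrix_(i, j) C i j.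
have comb (a : 'rV_N) : \sum_i a 0 i *: p i = \sum_j (a *m MC) 0 j *: b j.
  under eq_bigr do rewrite hC scaler_sumr.
  rewrite exchange_big; apply: eq_bigr => j _ /=.
  rewrite mxE scaler_suml; apply: eq_bigr => k _; by rewrite mxE scalerA.
have AC : MA *m MC = 1%:M.
  apply/row_matrixP => i; apply/rowP => j; rewrite row_mul.
  apply/eqP; rewrite -subr_eq0; apply/eqP.
  apply: (bfree (fun j => (row i MA *m MC) 0 j - row i 1%:M 0 j)).
  under eq_bigr do rewrite scalerBl.
  rewrite sumrB -comb.
  have -> : \sum_k row i MA 0 k *: p k = b i.
    by rewrite [RHS]hA; apply: eq_bigr => k _; rewrite !mxE.
  rewrite (bigD1 i) //= !mxE eqxx scale1r big1 ?addr0 ?subrr // => k /negPf ki.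
  by rewrite !mxE eq_sym ki scale0r.
have CA := mulmx1C AC.
pose a : 'rV_N := \row_i c i.
have aC : a *m MC = 0.
  apply/rowP => j; rewrite [RHS]mxE; apply: (bfree (fun j => (a *m MC) 0 j)).
  by rewrite -comb -[RHS]c0; apply: eq_bigr => i _; rewrite mxE.
have : a = 0 by rewrite -[a]mulmx1 -CA mulmxA aC mul0mx.
by move=> /rowP a0 i; have := a0 i; rewrite !mxE.
Qed.

End Free.

Lemma comps_mindex m w : (0 < m)%N -> w \in comps m -> is_mindex w.
Proof.
move=> m0; rewrite mem_comps /is_mindex => /andP[-> /eqP sw]; rewrite andbT.
by apply: contraTneq m0 => w0; rewrite -sw w0.
Qed.

(** The Lyndon products span the same space as the words of weight [m] and are indexed by them, so
    [free_same_span] applies. *)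
Lemma lyndon_prod_free m (c : seq nat -> rat) : (0 < m)%N ->
  \sum_(w <- comps m) c w *: lyndon_prod w = 0 ->
  forall w, w \in comps m -> c w = 0.
Proof.
move=> m0; set N := size (comps m); pose W i := nth [::] (comps m) i.
have WI (i : 'I_N) : W i \in comps m by apply: mem_nth.
have WM i := comps_mindex m0 (WI i).
have Ws (i : 'I_N) : sumn (W i) = m by move: (WI i); rewrite mem_comps => /andP[_ /eqP].
have Wk (w : seq nat) : w \in comps m -> exists i : 'I_N, W i = w.
  by move=> /(nthP [::])[i iN <-]; exists (Ordinal iN).
have WV (w : seq nat) : is_mindex w -> sumn w = m -> w \in comps m.
  by move=> /andP[_ w0] sw; rewrite mem_comps w0 sw eqxx.
have bfree (d : 'I_N -> rat) : \sum_i d i *: basis_vec (W i) = 0 -> forall i, d i = 0.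
  move=> d0 i; have [k ek] := mindex_word (WM i).
  have e : \sum_j d j * (j == i)%:R = 0.
    transitivity ((\sum_j d j *: basis_vec (W j))@_k); last by rewrite d0 mcoeff0.
    rewrite mcoeff_sum; apply: eq_bigr => j _; have [l el] := mindex_word (WM j).
    rewrite -el basis_vecE mcoeffZ mcoeff_ebasis; congr (_ * (nat_of_bool _)%:R).
    rewrite -[LHS]val_eqE -[RHS]val_eqE /=.
    rewrite -(nth_uniq [::] (ltn_ord j) (ltn_ord i) (comps_uniq m)).
    by rewrite -/(W j) -/(W i) -el -ek.
  move: e; rewrite (bigD1 i) //= eqxx mulr1 big1 ?addr0 // => j /negPf ->.
  by rewrite mulr0.
have pb (i : 'I_N) : lin_span (range (fun i : 'I_N => basis_vec (W i))) (lyndon_prod (W i)).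
  have := lyndon_prod_V (WM i); rewrite Ws; apply: lin_span_sub => _ [k wk <-].
  by have [j ej] := Wk _ (WV _ (valP k) wk); exists j; rewrite ?ej ?basis_vecE.
have bp (i : 'I_N) : lin_span (range (fun i : 'I_N => lyndon_prod (W i))) (basis_vec (W i)).
  have := lyndon_prod_span (WM i); rewrite Ws; apply: lin_span_sub => _ [w [hw sw] <-].
  by have [j ej] := Wk _ (WV _ hw sw); exists j; rewrite ?ej.
rewrite (big_nth [::]) big_mkord => /(free_same_span bfree pb bp) h w /Wk[i <-].
exact: h.
Qed.

(** * Injectivity and grading of u sigma *)

Definition psums (w : seq nat) : seq nat :=
  [seq sumn (take i w) | i <- iota 1 (size w).-1].

Lemma psums_cons a b w : psums (a :: b :: w) = a :: [seq (a + s)%N | s <- psums (b :: w)].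
Proof.
rewrite /psums /= addn0; congr (_ :: _).
by rewrite (iotaDl 1 1) -!map_comp; apply: eq_map => i.
Qed.

Lemma psums_neq0 w : 0%N \notin w -> 0%N \notin psums w.
Proof.
case: w => // a w; rewrite inE negb_or eq_sym => /andP[a0 _].
case: w => [|b w] //; rewrite psums_cons inE negb_or eq_sym a0.
by apply/mapP => -[s _]; lia.
Qed.

Lemma psums_uniq w : 0%N \notin w -> uniq (psums w).
Proof.
elim: w => // a [|b w] IH //; rewrite inE negb_or => /andP[_ w0].
rewrite psums_cons cons_uniq map_inj_uniq ?IH ?andbT //; last exact: addnI.
apply/mapP => -[s sw e]; have s0 : s = 0%N by lia.
by move: (psums_neq0 w0); rewrite -s0 sw.
Qed.

(* The binary digits 1 of [bnum w] sit at the partial sums, so refining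
   a word adds digits. *)
Lemma bnum_psums w : is_mindex w ->
  bnum w = (2 ^ (sumn w).-1 + \sum_(s <- psums w) 2 ^ (sumn w - s).-1)%N.
Proof.
elim: w => // a w IH haw.
have [a' ea] : exists a', a = a'.+1.
  by case: a haw => [|a'] //; exists a'.
case: w IH haw => [|b w] IH haw.
  by rewrite /psums big_nil ea /= expnS mul2n doubleK !addn0 muln1.
have hw : is_mindex (b :: w) by move: haw; rewrite -cat1s mindex_cat // => /andP[].
have w0 := mindex_sumn hw.
rewrite psums_cons big_cons big_map [LHS]/= -/(bnum (b :: w)) -/(sumn (b :: w)).
rewrite IH // ea expnS mul2n doubleK -expnD.
have -> : sumn (a'.+1 :: b :: w) = (a'.+1 + sumn (b :: w))%N by [].
rewrite addKn addSn /=; congr (_ + (_ + _))%N.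
by apply: eq_bigr => s _; rewrite -addSn subnDl.
Qed.

(** The digits 1 of the coarser code are among those of the finer one, and distinct words have
    distinct codes. *)
Lemma refines_bnum k l : refines k l -> k <> l -> (bnum (val l) < bnum (val k))%N.
Proof.
move=> [wkl sub] kl; rewrite ltn_neqAle; apply/andP; split.
  apply/eqP => e; apply: kl; apply/val_inj/esym/bnum_inj => //.
    by case/andP: (valP l).
  by case/andP: (valP k).
have /andP[_ k0] := valP k; have /andP[_ l0] := valP l.
rewrite (bnum_psums (valP k)) (bnum_psums (valP l)).
rewrite -[sumn (val l)]/(weight l) -wkl /weight leq_add2l.
have pm : perm_eq (psums (val l)) [seq s <- psums (val k) | s \in psums (val l)].
  apply: uniq_perm; rewrite ?filter_uniq ?psums_uniq // => s.
  by rewrite mem_filter; apply/idP/andP => [sl|[]//]; split=> //; apply: sub.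
rewrite (perm_big _ pm) big_filter big_mkcond; apply: leq_sum => s _.
by case: ifP.
Qed.

Lemma mcoeff_refinements k l :
  (\sum_(n \in [set n | refines n l]) ebasis n)@_k = (`[< refines k l >])%:R.
Proof.
rewrite fsbig_finite; last exact: finite_refines.
rewrite mcoeff_sum; under eq_bigr do rewrite mcoeff_ebasis.
case: asboolP => h.
  rewrite (bigD1_seq k) ?fset_uniq //=; last first.
    by rewrite in_fset_set ?inE //; apply: finite_refines.
  by rewrite eqxx big1 ?addr0 // => n /negPf ->.
rewrite big_seq big1 // => n; rewrite in_fset_set ?inE => [hn|]; last exact: finite_refines.
by case: eqP => // nk; case: h; rewrite -nk.
Qed.

Lemma mcoeff_u_sigma v k : ((u \o sigma) v)@_k =
  \sum_(l <- msupp v) v@_l * (-1) ^+ length l * (`[< refines k l >])%:R.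
Proof.
rewrite /= /sigma {1}/lin_ext /u linear_sum mcoeff_sum; apply: eq_bigr => l _.
by rewrite scalerA linearZ /= lin_extU mcoeffZ mcoeff_refinements.
Qed.

Lemma u_sigma_linear a v w :
  (u \o sigma) (a *: v + w) = a *: (u \o sigma) v + (u \o sigma) w.
Proof.
have e1 : sigma (a *: v + w) = a *: sigma v + sigma w by exact: lin_ext_is_linear.
have e2 x y : u (a *: x + y) = a *: u x + u y by exact: lin_ext_is_linear.
exact: etrans (congr1 u e1) (e2 _ _).
Qed.

Lemma u_sigma_weight0 v k : (forall l, weight l = weight k -> v@_l = 0) ->
  ((u \o sigma) v)@_k = 0.
Proof.
move=> h; rewrite mcoeff_u_sigma big1 // => l _.
case: asboolP => [[wkl _]|_]; last by rewrite mulr0.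
by rewrite h ?mul0r.
Qed.

Lemma u_sigma_V m v : V_ m v -> V_ m ((u \o sigma) v).
Proof.
move=> /V_weightP h; apply/V_weightP => k wk; apply: u_sigma_weight0 => l wl.
by apply: h; rewrite wl.
Qed.

(** The map is triangular for the order by codes, with diagonal entries 1 or -1, so the coefficients
    of [v] vanish by induction on the code. *)
Lemma u_sigma_ker v : (u \o sigma) v = 0 -> v = 0.
Proof.
move=> v0; apply/malgP => k; rewrite mcoeff0.
have [n] := ubnP (bnum (val k)); elim: n k => // n IH k; rewrite ltnS => kn.
have := congr1 (mcoeff k) v0; rewrite mcoeff_u_sigma mcoeff0.
have [kv|kv] := boolP (k \in msupp v); last by rewrite mcoeff_outdom.
rewrite (bigD1_seq k) ?fset_uniq //= big1 ?addr0 => [|l lk].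
  have -> : `[< refines k k >] = true by apply/asboolP; split.
  by rewrite mulr1 => /eqP; rewrite mulf_eq0 signr_eq0 orbF => /eqP.
case: asboolP => [rkl|_]; last by rewrite mulr0.
rewrite IH ?mul0r //; apply: leq_trans kn; apply: refines_bnum rkl _.
by move=> e; rewrite e eqxx in lk.
Qed.

(** Separates the weight [m] part of [v]. The property is linear in [v], so it suffices to treat a
    product of two words, which is homogeneous: it is either all of the first summand or all of the
    second. *)
Lemma VV_decomposable_split m v : VV v -> exists v' v'',
  [/\ v = v' + v'', lin_span (decomposables m) v'
    & forall k, weight k = m -> v''@_k = 0].
Proof.
pose T := [set v | exists v' v'', [/\ v = v' + v'', lin_span (decomposables m) v'
    & forall k, weight k = m -> v''@_k = 0]].
have T0 : T 0.
  exists 0, 0; split; [by rewrite addr0|exact: lin_span0|by move=> k; rewrite mcoeff0].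
have TD a x y : T x -> T y -> T (a *: x + y).
  move=> [x1 [x2 [-> hx1 hx2]]] [y1 [y2 [-> hy1 hy2]]].
  exists (a *: x1 + y1), (a *: x2 + y2); split.
  - by rewrite scalerDr addrACA.
  - exact: lin_span_lin.
  by move=> k wk; rewrite mcoeffD mcoeffZ hx2 // hy2 // mulr0 addr0.
have Tsum (I : Type) (r : seq I) (c : I -> rat) (f : I -> V) :
    (forall i, T (f i)) -> T (\sum_(i <- r) c i *: f i).
  by move=> Tf; elim/big_rec: _ => // i x _; apply: TD.
apply: (@lin_span_ind _ _ _ T) => // _ [x _ [y _ <-]]; rewrite /harm.
rewrite -[X in T X](_ : \sum_(k <- msupp x) x@_k *:
  \sum_(n <- msupp y) y@_n *: harm_basis k n = _); last first.
  apply: eq_bigr => k _; rewrite scaler_sumr; apply: eq_bigr => n _.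
  by rewrite scalerA.
apply: (Tsum _ _ (fun k => x@_k) _) => k.
apply: (Tsum _ _ (fun l => y@_l) _) => l; rewrite -harmU -!basis_vecE.
have hd := harm_lyndon_prods (lyndon_prod_span (valP k)) (lyndon_prod_span (valP l)).
have [e|ne] := eqVneq (sumn (val k) + sumn (val l))%N m.
  exists (harm (basis_vec (val k)) (basis_vec (val l))), 0.
  by rewrite addr0 -{1}e; split=> // n _; rewrite mcoeff0.
exists 0, (harm (basis_vec (val k)) (basis_vec (val l))); split.
- by rewrite add0r.
- exact: lin_span0.
have /V_weightP h := harm_V (basis_vec_V (valP k)) (basis_vec_V (valP l)).
by move=> n wn; apply: h => e; case/eqP: ne; rewrite -e.
Qed.

(** A word that is not Lyndon has a first factor and a nonempty rest, which exhibit its Lyndon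
    product as a product of two elements. *)
Lemma decomposables_VV m : decomposables m `<=` VV.
Proof.
move=> _ [w [hw _ lw] <-]; apply: lin_span_incl.
have /andP[_ /facP[/andP[aw _] ew]] := hw.
rewrite /lyndon_prod; case: (fac w) (fac_nil hw) aw ew => // x [|y L] _.
  by rewrite /= cats0 andbT => hx ex; rewrite ex in hx; rewrite hx in lw.
move=> _ _; rewrite (@harm_prod_cat [:: x]) //.
by exists (harm_prod [:: x]) => //; exists (harm_prod (y :: L)).
Qed.

Definition nonlyndons m := [seq w <- comps m | ~~ lyndon w].

Lemma u_sigma_dim m : (0 < m)%N ->
  has_dim (((u \o sigma) @` VV) `&` V_ m) (size (nonlyndons m)).
Proof.
(* From here on only linearity, injectivity and compatibility with the weight are used of
   [u \o sigma]. *)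
move: u_sigma_linear u_sigma_ker u_sigma_V u_sigma_weight0.
move: (u \o sigma) => f f_linear f_ker f_V f_weight0 m0.
pose W i := nth [::] (nonlyndons m) i.
have WI (i : 'I_(size (nonlyndons m))) : W i \in nonlyndons m by apply: mem_nth.
have f0 : f 0 = 0.
  by have := f_linear (-1) 0 0; rewrite scaleN1r addNr scaleN1r addNr.
have f_sum (I : Type) (r : seq I) (c : I -> rat) (g : I -> V) :
    f (\sum_(i <- r) c i *: g i) = \sum_(i <- r) c i *: f (g i).
  elim: r => [|i r IH]; first by rewrite [in LHS]big_nil big_nil.
  by rewrite [in LHS]big_cons f_linear IH big_cons.
have dW (i : 'I_(size (nonlyndons m))) : decomposables m (lyndon_prod (W i)).
  exists (W i) => //; move: (WI i); rewrite mem_filter => /andP[nl wc].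
  split=> //; first exact: comps_mindex wc.
  by move: wc; rewrite mem_comps => /andP[_ /eqP].
exists (fun i => f (lyndon_prod (W i))); split.
  move=> c; rewrite -f_sum => /f_ker c0 i.
  (* Extends [c] by 0 to the Lyndon words, so that the freeness of all Lyndon products of weight [m]
     applies. *)
  pose d (w : seq nat) : rat :=
    if insub (index w (nonlyndons m)) is Some j then c j else 0.
  have dWi (j : 'I_(size (nonlyndons m))) : d (W j) = c j.
    rewrite /d index_uniq ?filter_uniq ?comps_uniq // insubT //.
    by move=> jm; congr c; apply: val_inj.
  rewrite -dWi; apply: (lyndon_prod_free m0); last first.
    by have := WI i; rewrite mem_filter => /andP[].
  rewrite (bigID (fun w => lyndon w)) /= big1 ?add0r => [|w lw].
    rewrite -big_filter (big_nth [::]) big_mkord -[RHS]c0.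
    by apply: eq_bigr => j _; rewrite -/(W j) dWi.
  rewrite /d insubF ?scale0r //; apply/negbTE; rewrite index_mem mem_filter.
  by rewrite lw.
apply/seteqP; split=> [x [[v hv <-] xm]|].
  have [v1 [v2 [ev hv1 hv2]]] := VV_decomposable_split m hv.
  have dec_sub : lin_span (decomposables m) `<=` V_ m.
    apply: lin_span_ind; [exact: lin_span0|exact: lin_span_lin|].
    by move=> _ [w [hw <- _] <-]; apply: lyndon_prod_V.
  (* In weight [m], [f v2] vanishes because [v2] does; in the other weights because it is the
     difference of [f v] and [f v1], both in [V_ m]. *)
  have v20 : f v2 = 0.
    apply/malgP => k; rewrite mcoeff0; have [wk|/eqP wk] := eqVneq (weight k) m.
      by apply: f_weight0 => l wl; apply: hv2; rewrite wl.
    have -> : f v2 = f v - f v1.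
      by rewrite ev -[v1]scale1r f_linear !scale1r addrC addKr.
    move: xm (f_V _ _ (dec_sub _ hv1)) => /V_weightP xm /V_weightP xm1.
    by rewrite mcoeffB xm // xm1 // subrr.
  have -> : f v = f v1.
    by rewrite ev -[v1]scale1r f_linear v20 addr0 !scale1r.
  pose T := [set v | lin_span (range (fun i : 'I_(size (nonlyndons m)) =>
    f (lyndon_prod (W i)))) (f v)].
  apply: (@lin_span_ind _ _ _ T) hv1 => [|a y z Ty Tz|_ [w [hw sw lw] <-]].
  - by rewrite /T /mkset f0; apply: lin_span0.
  - have e := f_linear a y z; rewrite /T /mkset e; exact: (lin_span_lin a Ty Tz).
  apply: lin_span_incl.
  have wN : w \in nonlyndons m.
    by rewrite mem_filter lw mem_comps sw eqxx andbT; case/andP: hw.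
  have iN : (index w (nonlyndons m) < size (nonlyndons m))%N by rewrite index_mem.
  by exists (Ordinal iN) => //; rewrite /W nth_index.
move=> x /lin_span_rangeP[c ->]; rewrite -f_sum.
have hspan : lin_span (decomposables m)
    (\sum_(i < size (nonlyndons m)) c i *: lyndon_prod (W i)).
  exact: lin_span_sum.
split.
  eexists; last by reflexivity.
  apply: (@lin_span_ind _ _ (decomposables m) VV) hspan.
  - exact: lin_span0.
  - exact: lin_span_lin.
  exact: decomposables_VV.
apply: f_V; apply: (@lin_span_ind _ _ (decomposables m) (V_ m)) hspan.
- exact: lin_span0.
- exact: lin_span_lin.
by move=> _ [w [hw <- _] <-]; apply: lyndon_prod_V.
Qed.

Unset Implicit Arguments.

Theorem corollary6p5 (m : nat) (hm : (2 <= m)%N) :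
  exists n : nat,
    has_dim (((u \o sigma) @` VV) `&` V_ m) n /\
    n%:R = 2 ^+ m.-1
           - m%:R^-1 * \sum_(d <- divisors m) (moebius (m %/ d))%:~R * 2 ^+ d
           :> rat.
Proof.
have m0 : (0 < m)%N by apply: ltnW.
exists (size (nonlyndons m)); split; first exact: u_sigma_dim.
(* The compositions of [m] split into Lyndon and non-Lyndon words. *)
have sz : (size (nonlyndons m) + size (lyndons m) = 2 ^ m.-1)%N.
  by rewrite -(size_comps m.-1) prednK // !size_filter addnC count_predC.
have -> : \sum_(d <- divisors m) (moebius (m %/ d))%:~R * 2 ^+ d =
    m%:R * (size (lyndons m))%:R :> rat.
  have := congr1 (fun z : int => z%:~R : rat) (lyndons_moebius hm).
  rewrite rmorphM rmorph_sum /= => ->; apply: eq_bigr => d _.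
  by rewrite rmorphM rmorphXn.
by rewrite mulKf ?pnatr_eq0 -?lt0n // -natrX -sz natrD addrK.
Qed.
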